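(* Let $p$ be an odd prime and let $K$ be an imaginary quadratic field in which $p$ splits into two primes $\mathfrak{p}, \overline{\mathfrak{p}}$. Let $L$ be an abelian extension of $K$ which is a finite extension of $\widetilde{K}$, the $\mathbb{Z}_p^2$-extension of $K$. Let $\Sigma$ be a finite set of places of $K$ containing all primes above $p$ and all primes ramified in $L/K$, and put $\Sigma_0=\Sigma\setminus\{\overline{\mathfrak p}\}$. Then for $R=\mathbb{Z}_p[[\mathrm{Gal}(L/K)]]$ and $\mathcal{F}=\mathrm{Fitt}_R$, we have \[ \mathcal{F}(X_{\Sigma_0}(L)) = \mathcal{F}(\Phi_{L/K,\Sigma_0})\, \mathcal{F}^{[2]}(\mathbb{Z}_p). \]
   Context: $X_{\Sigma_0}(L)$ is the Galois group of the maximal abelian pro-$p$ extension of $L$ unramified outside $\Sigma_0$, a module over $R$. Let $G=\mathrm{Gal}(L/K)$, $G'\simeq\mathbb Z_p^2$ an open subgroup of $G$, $\Lambda=\mathbb Z_p[[G']]$, $S=\Lambda\setminus\{0\}$. Let $\mathcal M$ be the category of finitely generated $S$-torsion $R$-modules and $\mathcal P=\{P\in\mathcal M\mid \mathrm{pd}_R(P)\le1\}$. $\mathbb Z_p$ carries the trivial action. $\mathrm{Fitt}_R(M)$ denotes the initial Fitting ideal (generated by the $a\times a$ minors of a presentation matrix $R^b\to R^a\to M\to 0$), regarded in the commutative monoid $\Omega$ of finitely generated $R$-submodules of $S^{-1}R$. For $P\in\mathcal P$, $\mathrm{Fitt}_R(P)$ is invertible in $\Omega$, and $\mathcal F$ restricted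 to $\mathcal P$ induces a group homomorphism $\mathcal F:K_0(\mathcal P)\to\Omega^\times$ on the Grothendieck group of the exact category $\mathcal P$. There is an exact sequence $0\to X_{\Sigma_0}(L)\to P_1\to P_2\to\mathbb Z_p\to0$ in $\mathcal M$ with $P_1,P_2\in\mathcal P$; using it, put $\Phi_{L/K,\Sigma_0}=[P_1]-[P_2]\in K_0(\mathcal P)$. For $M\in\mathcal M$, take an exact sequence $0\to N\to P_1\to P_2\to M\to0$ in $\mathcal M$ with $P_1,P_2\in\mathcal P$ and put $\mathcal F^{[2]}(M)=\mathcal F(P_1)^{-1}\mathcal F(P_2)\mathcal F(N)$; this is independent of the choice. *)

(* Defs.v *)
From HB Require Import structures.
From mathcomp Require Import all_boot all_order all_algebra all_field.
From mathcomp Require Import generic_quotient.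
From mathcomp Require Import boolp classical_sets cardinality.
From mathcomp Require Import ring.

Set Implicit Arguments.
Unset Strict Implicit.
Unset Printing Implicit Defensive.

Import Order.TTheory GRing.Theory Num.Theory.
Local Open Scope ring_scope.
Local Open Scope quotient_scope.
Local Open Scope classical_set_scope.

(* Z_p is the inverse limit of the rings Z/p^(n+1); the index is shifted because
   'Z_1 is not the zero ring. *)
Definition padic_compat (p : nat) (x : forall n, 'Z_(p ^ n.+1)) : Prop :=
  forall n, (x n.+1 : nat)%:R = x n.

Record padic (p : nat) := Padic {
  padic_val :> forall n, 'Z_(p ^ n.+1);
  padicP : padic_compat padic_val }.

HB.instance Definition _ p := gen_eqMixin (padic p).
HB.instance Definition _ p := gen_choiceMixin (padic p).

Lemma padic_ext p (x y : padic p) : (forall n, x n = y n) -> x = y.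
Proof.
case: x y => [x hx] [y hy] /= e.
have {}e : x = y by apply: functional_extensionality_dep.
by move: hx hy; rewrite e => hx hy; rewrite (Prop_irrelevance hx hy).
Qed.

Section Padic.
Variable p : nat.

Lemma Zmod_dvd n :
  ((Zp_trunc (p ^ n.+1)).+2 %| (Zp_trunc (p ^ n.+2)).+2)%N.
Proof.
case: (leqP p 1) => hp; last first.
  have h m : (1 < p ^ m.+1)%N.
    by rewrite expnS (leq_trans hp) // leq_pmulr // expn_gt0 (ltnW hp).
  by rewrite !Zp_cast // dvdn_exp2l.
suff e m : Zp_trunc (p ^ m.+1) = 0%N by rewrite !e.
by case: p hp => [|[|k]] //= _; rewrite ?exp0n ?exp1n.
Qed.

Lemma Zmod_natr n k :
  (k %% (Zp_trunc (p ^ n.+2)).+2)%:R = k%:R :> 'Z_(p ^ n.+1).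
Proof.
by apply: val_inj; rewrite !Zp_nat /= modn_dvdm // Zmod_dvd.
Qed.

Lemma padic0_subproof : padic_compat (fun n => 0 : 'Z_(p ^ n.+1)).
Proof. by move=> n. Qed.
Lemma padic1_subproof : padic_compat (fun n => 1 : 'Z_(p ^ n.+1)).
Proof. by move=> n. Qed.
Lemma padicD_subproof (x y : padic p) : padic_compat (fun n => x n + y n).
Proof.
by move=> n; rewrite -(padicP x n) -(padicP y n) -natrD [LHS]Zmod_natr.
Qed.
Lemma padicM_subproof (x y : padic p) : padic_compat (fun n => x n * y n).
Proof.
by move=> n; rewrite -(padicP x n) -(padicP y n) -natrM [LHS]Zmod_natr.
Qed.
Lemma padicN_subproof (x : padic p) : padic_compat (fun n => - x n).
Proof.
move=> n; rewrite -(padicP x n); apply/eqP.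
rewrite -subr_eq0 opprK -natrD -Zmod_natr.
have -> : (((- x n.+1)%R + x n.+1) %% (Zp_trunc (p ^ n.+2)).+2)%N = 0%N.
  by have /(congr1 val) := addNr (x n.+1).
by [].
Qed.

Definition padic0 : padic p := Padic padic0_subproof.
Definition padic1 : padic p := Padic padic1_subproof.
Definition padic_add x y : padic p := Padic (padicD_subproof x y).
Definition padic_mul x y : padic p := Padic (padicM_subproof x y).
Definition padic_opp x : padic p := Padic (padicN_subproof x).

Lemma padic_addA : associative padic_add.
Proof. by move=> x y z; apply: padic_ext => n; apply: addrA. Qed.
Lemma padic_addC : commutative padic_add.
Proof. by move=> x y; apply: padic_ext => n; apply: addrC. Qed.
Lemma padic_add0 : left_id padic0 padic_add.
Proof. by move=> x; apply: padic_ext => n; apply: add0r. Qed.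
Lemma padic_addN : left_inverse padic0 padic_opp padic_add.
Proof. by move=> x; apply: padic_ext => n; apply: addNr. Qed.
HB.instance Definition _ := GRing.isZmodule.Build (padic p)
  padic_addA padic_addC padic_add0 padic_addN.

Lemma padic_mulA : associative padic_mul.
Proof. by move=> x y z; apply: padic_ext => n; apply: mulrA. Qed.
Lemma padic_mulC : commutative padic_mul.
Proof. by move=> x y; apply: padic_ext => n; apply: mulrC. Qed.
Lemma padic_mul1 : left_id padic1 padic_mul.
Proof. by move=> x; apply: padic_ext => n; apply: mul1r. Qed.
Lemma padic_mulD : left_distributive padic_mul +%R.
Proof. by move=> x y z; apply: padic_ext => n; apply: mulrDl. Qed.
Lemma padic_1neq0 : padic1 != 0.
Proof.
apply/eqP => /(congr1 (fun x : padic p => x 0%N)) /eqP.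
by rewrite oner_eq0.
Qed.
HB.instance Definition _ := GRing.Zmodule_isComNzRing.Build (padic p)
  padic_mulA padic_mulC padic_mul1 padic_mulD padic_1neq0.

End Padic.

Definition subgroup (G : groupType) (U : set G) : Prop :=
  [/\ U 1%g, forall g h, U g -> U h -> U (g * h)%g & forall g, U g -> U g^-1%g].

(* [s] contains exactly one element of each left coset [g U]. *)
Definition coset_reps (G : groupType) (U : set G) (s : seq G) : Prop :=
  forall g : G, count (fun h => `[< U (g^-1 * h)%g >]) s = 1%N.

Record abTopGroup := AbTopGroup {
  atg_group :> groupType;
  atg_open : set (set atg_group);
  atg_comm : forall g h : atg_group, (g * h = h * g)%g;
  atg_openT : atg_open setT;
  atg_subgroup : forall U, atg_open U -> subgroup U;
  atg_finite : forall U, atg_open U -> exists s, coset_reps U s }.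

Record openSub (G : abTopGroup) := OpenSub {
  openSub_set :> G -> Prop;
  openSubP : atg_open openSub_set }.

Definition openSubT (G : abTopGroup) : openSub G := OpenSub (atg_openT G).

Definition transv (G : abTopGroup) (U : openSub G) : seq G :=
  xget [::] [set s | coset_reps U s].

(* Elements of Z_p[[G]] = lim_U Z_p[G/U]: the family of the coefficients
   [x U g] of the coset g U in the image of x in Z_p[G/U].  The second
   condition is compatibility with Z_p[G/U] -> Z_p[G/V]. *)
Definition iwasawa_compat (p : nat) (G : abTopGroup)
    (x : openSub G -> G -> padic p) : Prop :=
  (forall (U : openSub G) g h, U (g^-1 * h)%g -> x U g = x U h) /\
  (forall U V : openSub G, U `<=` V ->
     forall g, x V g = \sum_(h <- transv U | `[< V (g^-1 * h)%g >]) x U h).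

Record iwasawa (p : nat) (G : abTopGroup) := Iwasawa {
  iwasawa_coef :> openSub G -> G -> padic p;
  iwasawaP : iwasawa_compat iwasawa_coef }.

HB.instance Definition _ p G := gen_eqMixin (iwasawa p G).
HB.instance Definition _ p G := gen_choiceMixin (iwasawa p G).

Lemma iwasawa_ext p G (x y : iwasawa p G) :
  (forall U g, x U g = y U g) -> x = y.
Proof.
case: x y => [x hx] [y hy] /= e.
have {}e : x = y by apply/funext => U; apply/funext => g.
by move: hx hy; rewrite e => hx hy; rewrite (Prop_irrelevance hx hy).
Qed.

Section Iwasawa.
Variables (p : nat) (G : abTopGroup).
Implicit Types (U V : openSub G) (g h k : G).

Lemma transvP U : coset_reps U (transv U).
Proof. by apply: xgetPex; apply: atg_finite; apply: openSubP. Qed.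

Let mgC g h : (g * h = h * g)%g. Proof. exact: atg_comm. Qed.

Lemma open1 U : U 1%g. Proof. by case: (atg_subgroup (openSubP U)). Qed.
Lemma openM U g h : U g -> U h -> U (g * h)%g.
Proof. by case: (atg_subgroup (openSubP U)) => _ + _; apply. Qed.
Lemma openV U g : U g -> U g^-1%g.
Proof. by case: (atg_subgroup (openSubP U)) => _ _; apply. Qed.

Definition sameco U g h : bool := `[< U (g^-1 * h)%g >].

Lemma sameco_refl U g : sameco U g g.
Proof. by apply/asboolP; rewrite mulVg; apply: open1. Qed.
Lemma sameco_symI U g h : sameco U g h -> sameco U h g.
Proof.
by move=> /asboolP /openV; rewrite invgM invgK => ?; apply/asboolP.
Qed.
Lemma sameco_sym U g h : sameco U g h = sameco U h g.
Proof. by apply/idP/idP; apply: sameco_symI. Qed.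
Lemma sameco_trans U g h k : sameco U g h -> sameco U h k -> sameco U g k.
Proof.
move=> /asboolP a /asboolP b; apply/asboolP.
by have := openM a b; rewrite mulgA -(mulgA _ h) mulgV mulg1.
Qed.
Lemma sameco_eqr U g h k : sameco U h k -> sameco U g h = sameco U g k.
Proof.
move=> hk; apply/idP/idP => e; first exact: sameco_trans e hk.
by apply: (sameco_trans e); apply: sameco_symI.
Qed.
Lemma sameco_mull U g h k : sameco U (k * g) (k * h) = sameco U g h.
Proof. by rewrite /sameco invgM -mulgA (mulgA k^-1%g) mulVg mul1g. Qed.
Lemma sameco_inv U g h : sameco U g^-1 h^-1 = sameco U g h.
Proof. by rewrite [RHS]sameco_sym /sameco invgK mgC. Qed.

Definition invar U (F : G -> padic p) := forall g h, sameco U g h -> F g = F h.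

Lemma sum_sameco U s g (a : padic p) : coset_reps U s ->
  \sum_(h <- s | sameco U g h) a = a.
Proof. by move=> /(_ g) hs; rewrite big_const_seq hs /= addr0. Qed.

Lemma transv_eq U s t F : coset_reps U s -> coset_reps U t -> invar U F ->
  \sum_(h <- s) F h = \sum_(h <- t) F h.
Proof.
move=> hs ht hF.
transitivity (\sum_(h <- s) \sum_(k <- t | sameco U h k) F h).
  by apply: eq_bigr => h _; rewrite sum_sameco.
under eq_bigr => h _ do rewrite big_mkcond.
rewrite exchange_big /=; apply: eq_bigr => k _.
rewrite -big_mkcond /= -[RHS](sum_sameco k (F k) hs).
apply: eq_big => [h|h hk]; first exact: sameco_sym.
exact: hF.
Qed.

Lemma transv_mul U s k : coset_reps U s ->
  coset_reps U [seq (k * h)%g | h <- s].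
Proof.
move=> hs g; rewrite count_map -[RHS](hs (k^-1 * g)%g); apply: eq_count => h /=.
by rewrite invgM invgK mulgA.
Qed.
Lemma transv_inv U s : coset_reps U s -> coset_reps U [seq h^-1%g | h <- s].
Proof.
move=> hs g; rewrite count_map -[RHS](hs g^-1%g); apply: eq_count => h /=.
by rewrite -/(sameco U g h^-1) -/(sameco U g^-1 h) -[in RHS](invgK h) sameco_inv.
Qed.

Definition tsum U (F : G -> padic p) := \sum_(h <- transv U) F h.

Lemma tsum_mul U k F : invar U F -> tsum U (fun h => F (k * h)%g) = tsum U F.
Proof.
move=> hF; rewrite /tsum -(big_map (fun h => k * h)%g xpredT F).
by apply: transv_eq hF; [apply: transv_mul|]; apply: transvP.
Qed.
Lemma tsum_inv U F : invar U F -> tsum U (fun h => F h^-1%g) = tsum U F.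
Proof.
move=> hF; rewrite /tsum -(big_map (fun h => h^-1)%g xpredT F).
by apply: transv_eq hF; [apply: transv_inv|]; apply: transvP.
Qed.
Definition conv U (F F' : G -> padic p) g :=
  \sum_(h <- transv U) F h * F' (h^-1 * g)%g.

Lemma conv_invar U F F' : invar U F' -> invar U (conv U F F').
Proof.
by move=> hF' g h gh; apply: eq_bigr => k _; rewrite (hF' _ (k^-1 * h)%g) ?sameco_mull.
Qed.

Lemma convC U F F' : invar U F -> invar U F' -> conv U F F' =1 conv U F' F.
Proof.
move=> hF hF' g.
have h1 : invar U (fun h => F h * F' (h^-1 * g)%g).
  move=> h k hk; rewrite (hF _ _ hk) (hF' _ (k^-1 * g)%g) //.
  by rewrite mgC (mgC k^-1%g) sameco_mull sameco_inv.
rewrite -[LHS](tsum_mul g h1) -[LHS]tsum_inv.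
  apply: eq_bigr => h _.
  by rewrite invgM invgK mulrC (mgC g) -(mulgA h) mulVg mulg1.
by move=> h k hk; apply: h1; rewrite sameco_mull.
Qed.

Lemma convA U F1 F2 F3 : invar U F1 -> invar U F2 -> invar U F3 ->
  conv U F1 (conv U F2 F3) =1 conv U (conv U F1 F2) F3.
Proof.
move=> h1 h2 h3 g.
transitivity (\sum_(h <- transv U) \sum_(k <- transv U)
   F1 h * F2 (h^-1 * k)%g * F3 (k^-1 * g)%g).
  apply: eq_bigr => h _; rewrite big_distrr /=.
  have hI : invar U (fun k => F1 h * (F2 k * F3 (k^-1 * (h^-1 * g))%g)).
    move=> k l kl; rewrite (h2 _ _ kl) (h3 _ (l^-1 * (h^-1 * g))%g) //.
    by rewrite mgC (mgC l^-1%g) sameco_mull sameco_inv.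
  rewrite -[LHS](tsum_mul h^-1 hI); apply: eq_bigr => k _.
  rewrite mulrA invgM invgK -mulgA (mulgA h) mulgV mul1g.
  by [].
rewrite exchange_big; apply: eq_bigr => k _.
by rewrite big_distrl.
Qed.

Definition push U V (F : G -> padic p) g := \sum_(h <- transv U | sameco V g h) F h.

Lemma sameco_sub U V g h : U `<=` V -> sameco U g h -> sameco V g h.
Proof. by move=> UV /asboolP /UV ?; apply/asboolP. Qed.

Lemma push_conv U V F F' : invar U F -> invar U F' -> U `<=` V ->
  push U V (conv U F F') =1 conv V (push U V F) (push U V F').
Proof.
move=> hF hF' UV g; rewrite /push /conv exchange_big /=.
transitivity (\sum_(k <- transv U) F k * push U V F' (k^-1 * g)%g).
  apply: eq_bigr => k _; rewrite -big_distrr /=; congr (_ * _).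
  rewrite big_mkcond /push [RHS]big_mkcond.
  have hI : invar U (fun h => if sameco V (k^-1 * g) h then F' h else 0).
    move=> h l hl; rewrite (hF' _ _ hl).
    by rewrite (sameco_eqr _ (sameco_sub UV hl)).
  rewrite -[RHS](tsum_mul k^-1 hI); apply: eq_bigr => h _.
  by rewrite sameco_mull.
under [RHS]eq_bigr => h _ do rewrite big_mkcond big_distrl /=.
rewrite exchange_big /=; apply: eq_bigr => k _.
rewrite -[LHS](sum_sameco k _ (transvP V)) big_mkcond; apply: eq_bigr => h _.
rewrite (sameco_sym V h); case: ifP => kh; last by rewrite mul0r.
congr (_ * _); apply: eq_bigl => l.
rewrite ![sameco V _ l]sameco_sym; apply: sameco_eqr.
by rewrite mgC (mgC h^-1%g) sameco_mull sameco_inv.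
Qed.

Lemma iwasawa_invar (x : iwasawa p G) U : invar U (x U).
Proof. by move=> g h /asboolP; case: (iwasawaP x) => + _; apply. Qed.
Lemma iwasawa_push (x : iwasawa p G) U V : U `<=` V ->
  x V =1 push U V (x U).
Proof. by case: (iwasawaP x) => _; apply. Qed.

Lemma iwasawa0_subproof : iwasawa_compat (fun U g => 0 : padic p).
Proof. by split=> // U V _ g; rewrite big1. Qed.
Lemma iwasawaD_subproof (x y : iwasawa p G) :
  iwasawa_compat (fun U g => x U g + y U g).
Proof.
split=> [U g h /asboolP gh|U V UV g].
  by congr (_ + _); apply: iwasawa_invar.
by rewrite !(iwasawa_push _ UV) -big_split.
Qed.
Lemma iwasawaN_subproof (x : iwasawa p G) : iwasawa_compat (fun U g => - x U g).
Proof.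
split=> [U g h /asboolP gh|U V UV g].
  by congr (- _); apply: iwasawa_invar.
by rewrite !(iwasawa_push _ UV) -sumrN.
Qed.
Lemma iwasawaM_subproof (x y : iwasawa p G) :
  iwasawa_compat (fun U g => \sum_(h <- transv U) x U h * y U (h^-1 * g)%g).
Proof.
split=> [U g h /asboolP gh|U V UV g].
  by apply: conv_invar gh; apply: iwasawa_invar.
rewrite -[RHS]/(push U V (conv U (x U) (y U)) g).
rewrite push_conv //; do ?exact: iwasawa_invar.
by apply: eq_bigr => h _; rewrite !(iwasawa_push _ UV).
Qed.

Lemma group_elt_subproof g :
  iwasawa_compat (fun U h => (`[< U (g^-1 * h)%g >] : nat)%:R : padic p).
Proof.
split=> [U h k /asboolP hk|U V UV h].
  by rewrite -!/(sameco _ _ _) (sameco_eqr _ hk).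
rewrite -/(sameco V g h) (eq_bigr (fun k => if sameco U g k then 1 else 0)); last first.
  by move=> k _; rewrite -/(sameco U g k); case: sameco.
rewrite -big_mkcondr /= (eq_bigl (fun k => sameco V g h && sameco U g k)); last first.
  move=> k; rewrite andbC; case gk: (sameco U g k); rewrite ?andbF ?andbT //.
  by rewrite -/(sameco V h k) sameco_sym [RHS]sameco_sym -!(sameco_sym V h)
     (sameco_eqr _ (sameco_sub UV gk)).
case: (sameco V g h); last by rewrite big_pred0.
by rewrite sum_sameco //; apply: transvP.
Qed.

Definition iwasawa0 : iwasawa p G := Iwasawa iwasawa0_subproof.
Definition iwasawa_add x y : iwasawa p G := Iwasawa (iwasawaD_subproof x y).
Definition iwasawa_opp x : iwasawa p G := Iwasawa (iwasawaN_subproof x).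
Definition iwasawa_mul x y : iwasawa p G := Iwasawa (iwasawaM_subproof x y).
Definition group_elt g : iwasawa p G := Iwasawa (group_elt_subproof g).

Lemma iwasawa_addA : associative iwasawa_add.
Proof. by move=> x y z; apply: iwasawa_ext => U g; apply: addrA. Qed.
Lemma iwasawa_addC : commutative iwasawa_add.
Proof. by move=> x y; apply: iwasawa_ext => U g; apply: addrC. Qed.
Lemma iwasawa_add0 : left_id iwasawa0 iwasawa_add.
Proof. by move=> x; apply: iwasawa_ext => U g; apply: add0r. Qed.
Lemma iwasawa_addN : left_inverse iwasawa0 iwasawa_opp iwasawa_add.
Proof. by move=> x; apply: iwasawa_ext => U g; apply: addNr. Qed.
HB.instance Definition _ := GRing.isZmodule.Build (iwasawa p G)
  iwasawa_addA iwasawa_addC iwasawa_add0 iwasawa_addN.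

Lemma iwasawa_mulA : associative iwasawa_mul.
Proof.
by move=> x y z; apply: iwasawa_ext => U g; apply: convA; apply: iwasawa_invar.
Qed.
Lemma iwasawa_mulC : commutative iwasawa_mul.
Proof.
by move=> x y; apply: iwasawa_ext => U g; apply: convC; apply: iwasawa_invar.
Qed.
Lemma iwasawa_mul1 : left_id (group_elt 1%g) iwasawa_mul.
Proof.
move=> x; apply: iwasawa_ext => U g /=.
rewrite -[RHS](sum_sameco 1%g _ (transvP U)) [RHS]big_mkcond.
apply: eq_bigr => h _.
rewrite -/(sameco U 1 h); case: ifP => h1; last by rewrite mul0r.
rewrite mul1r; apply: iwasawa_invar.
by rewrite -[X in sameco _ _ X]mul1g mgC [(1 * g)%g]mgC sameco_mull -(invg1 G) sameco_inv sameco_sym.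
Qed.
Lemma iwasawa_mulD : left_distributive iwasawa_mul +%R.
Proof.
move=> x y z; apply: iwasawa_ext => U g /=; rewrite -big_split.
by apply: eq_bigr => h _; apply: mulrDl.
Qed.
Lemma iwasawa_1neq0 : group_elt 1%g != 0.
Proof.
apply/eqP => /(congr1 (fun x : iwasawa p G => x (openSubT G) 1%g)) /=.
have /asboolP -> : [set: G] (1^-1 * 1)%g by [].
by move/eqP; rewrite oner_eq0.
Qed.
HB.instance Definition _ := GRing.Zmodule_isComNzRing.Build (iwasawa p G)
  iwasawa_mulA iwasawa_mulC iwasawa_mul1 iwasawa_mulD iwasawa_1neq0.

End Iwasawa.

(* Subfields of algC are [divringClosed algC].  An automorphism of L over K is
   represented by its extension by the identity outside L. *)
Definition is_Gal (K L : divringClosed algC) (s : algC -> algC) : Prop :=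
  [/\ {in L, forall x, s x \in L},
      {in L &, {morph s : x y / x + y}},
      {in L &, {morph s : x y / x * y}},
      {in K, forall x, s x = x} &
      {in L, forall y, exists2 x, x \in L & s x = y}] /\
  (forall x, x \notin L -> s x = x).

Record GalT (K L : divringClosed algC) := MkGal {
  Gal_fun :> algC -> algC;
  GalP : is_Gal K L Gal_fun }.

HB.instance Definition _ K L := gen_eqMixin (GalT K L).
HB.instance Definition _ K L := gen_choiceMixin (GalT K L).

Lemma Gal_ext K L (s t : GalT K L) : s =1 t -> s = t.
Proof.
case: s t => [s hs] [t ht] /= /funext e.
by move: hs ht; rewrite e => hs ht; rewrite (Prop_irrelevance hs ht).
Qed.

Section GalGroup.
Variables K L : divringClosed algC.
Implicit Types s t u : GalT K L.

Lemma Gal_in s x : x \in L -> s x \in L.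
Proof. by case: (GalP s) => -[+ _ _ _ _] _; apply. Qed.
Lemma Gal_out s x : x \notin L -> s x = x.
Proof. by case: (GalP s) => _; apply. Qed.
Lemma Gal_D s : {in L &, {morph s : x y / x + y}}.
Proof. by case: (GalP s) => -[]. Qed.
Lemma Gal_M s : {in L &, {morph s : x y / x * y}}.
Proof. by case: (GalP s) => -[]. Qed.
Lemma Gal_fix s : {in K, forall x, s x = x}.
Proof. by case: (GalP s) => -[]. Qed.
Lemma Gal_onto s : {in L, forall y, exists2 x, x \in L & s x = y}.
Proof. by case: (GalP s) => -[]. Qed.

Lemma Gal_inj_in s : {in L &, injective s}.
Proof.
move=> x y xL yL exy; apply/eqP; rewrite -subr_eq0; apply/eqP.
have dL : x - y \in L by rewrite rpredB.
have ed : s (x - y) = 0.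
  have := Gal_D s dL yL; rewrite subrK exy => /esym/eqP.
  by rewrite addrC -subr_eq0 addrAC subrr add0r => /eqP.
have [->//|nd] := eqVneq (x - y) 0; exfalso.
have vL : (x - y)^-1 \in L by rewrite rpredV.
have /eqP := Gal_M s dL vL.
by rewrite mulfV // ed mul0r (Gal_fix s (rpred1 K)) oner_eq0.
Qed.

Lemma Gal_inj s : injective s.
Proof.
move=> x y; have [xL|xL] := boolP (x \in L); have [yL|yL] := boolP (y \in L).
- exact: Gal_inj_in.
- by rewrite (Gal_out s yL) => e; move: yL; rewrite -e Gal_in.
- by rewrite (Gal_out s xL) => e; move: xL; rewrite e Gal_in.
- by rewrite !Gal_out.
Qed.

Lemma Gal_surj s y : exists x, s x = y.
Proof.
have [yL|yL] := boolP (y \in L); first by have [x _ <-] := Gal_onto s yL; exists x.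
by exists y; apply: Gal_out.
Qed.

Lemma Gal1_subproof : is_Gal K L id.
Proof. by split=> //; split=> // y yL; exists y. Qed.
Definition Gal1 : GalT K L := MkGal Gal1_subproof.

Lemma GalM_subproof s t : is_Gal K L (s \o t).
Proof.
split; last by move=> x xL /=; rewrite !Gal_out.
split=> /=.
- by move=> x xL; rewrite !Gal_in.
- by move=> x y xL yL /=; rewrite !Gal_D ?Gal_in.
- by move=> x y xL yL /=; rewrite !Gal_M ?Gal_in.
- by move=> x xK; rewrite !Gal_fix.
- move=> z /(Gal_onto s) [y /(Gal_onto t) [x xL <-] <-]; by exists x.
Qed.
Definition GalM s t : GalT K L := MkGal (GalM_subproof s t).

Definition GalV_fun s y : algC := xget y [set x | s x = y].
Lemma GalV_funK s : cancel (GalV_fun s) s.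
Proof. by move=> y; have [x <-] := Gal_surj s y; apply: (@xgetPex _ _ [set z | s z = s x]); exists x. Qed.

Lemma GalV_subproof s : is_Gal K L (GalV_fun s).
Proof.
have K' : cancel s (GalV_fun s) by move=> x; apply: (@Gal_inj s); rewrite GalV_funK.
have inL x : x \in L -> GalV_fun s x \in L.
  by move=> /(Gal_onto s) [y yL <-]; rewrite K'.
split; last by move=> x xL; rewrite -{1}(Gal_out s xL) K'.
split=> //.
- by move=> x y xL yL; apply: (@Gal_inj s); rewrite Gal_D ?GalV_funK ?inL.
- by move=> x y xL yL; apply: (@Gal_inj s); rewrite Gal_M ?GalV_funK ?inL.
- by move=> x xK; apply: (@Gal_inj s); rewrite GalV_funK Gal_fix.
- by move=> y yL; exists (s y); rewrite ?Gal_in ?K'.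
Qed.
Definition GalV s : GalT K L := MkGal (GalV_subproof s).

Lemma Gal_mulA : associative GalM.
Proof. by move=> s t u; apply: Gal_ext. Qed.
Lemma Gal_mul1 : left_id Gal1 GalM.
Proof. by move=> s; apply: Gal_ext. Qed.
Lemma Gal_mulr1 : right_id Gal1 GalM.
Proof. by move=> s; apply: Gal_ext. Qed.
Lemma Gal_mulV : left_inverse Gal1 GalV GalM.
Proof. by move=> s; apply: Gal_ext => x /=; apply: (@Gal_inj s); rewrite GalV_funK. Qed.
Lemma Gal_mulrV : right_inverse Gal1 GalV GalM.
Proof. by move=> s; apply: Gal_ext => x /=; rewrite GalV_funK. Qed.
HB.instance Definition _ := isGroup.Build (GalT K L)
  Gal_mulA Gal_mul1 Gal_mulr1 Gal_mulV Gal_mulrV.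

(* Krull topology: the pointwise stabilizers of finite subsets of L are a basis
   of neighbourhoods of 1. *)
Definition Gal_open (U : set (GalT K L)) : Prop :=
  subgroup U /\
  exists2 e : seq algC, {subset e <= L} &
    forall s : GalT K L, {in e, forall x, s x = x} -> U s.

Lemma Gal_openT : Gal_open setT.
Proof. by split; [split | exists [::]]. Qed.

Lemma Gal_horner s (q : {poly rat}) x : x \in L ->
  (map_poly ratr q).[x] \in L /\ s (map_poly ratr q).[x] = (map_poly ratr q).[s x].
Proof.
move=> xL; elim/poly_ind: q => [|q c [IH1 IH2]].
  by rewrite rmorph0 !horner0 rpred0 (Gal_fix s (rpred0 K)).
have cr (F : divringClosed algC) : ratr c \in F by apply: rpred_Crat; apply: Crat_rat.
have ML : (map_poly ratr q).[x] * x \in L by apply: rpredM.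
rewrite rmorphD rmorphM /= map_polyX map_polyC /= !hornerE; split.
  by apply: rpredD ML (cr L).
by rewrite (Gal_D s ML (cr L)) Gal_M // IH2 (Gal_fix s (cr K)).
Qed.

Lemma Gal_orbit x : x \in L -> exists r : seq algC, forall s, s x \in r.
Proof.
move=> xL; have [r er] := closed_field_poly_normal (minCpoly x).
exists r => s; have [q [eq _] _] := minCpolyP x.
have : root (minCpoly x) (s x).
  have [_] := Gal_horner s q xL; rewrite -eq (eqP (root_minCpoly x)) => /esym.
  by rewrite (Gal_fix s (rpred0 K)) => /eqP.
by rewrite er (monicP (minCpoly_monic x)) scale1r root_prod_XsubC.
Qed.

Lemma Gal_orbits (e : seq algC) : {subset e <= L} ->
  exists r : seq (seq algC), forall s, [seq s x | x <- e] \in r.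
Proof.
elim: e => [|x e IH] he; first by exists [:: [::]] => s; rewrite inE.
have [r hr] : exists r : seq (seq algC), forall s, [seq s y | y <- e] \in r.
  by apply: IH => y ye; apply: he; rewrite inE ye orbT.
have [q hq] := Gal_orbit (he x (mem_head _ _)).
exists [seq y :: v | y <- q, v <- r] => s; apply/allpairsP.
by exists (s x, [seq s y | y <- e]); split; [apply: hq | apply: hr |].
Qed.

Lemma transversal_of_cover (G : groupType) (U : set G) (t : seq G) :
  subgroup U -> (forall g, has (fun h => `[< U (g^-1 * h)%g >]) t) ->
  exists r, coset_reps U r.
Proof.
case=> U1 UM UV ht; pose e g h := `[< U (g^-1 * h)%g >].
have esym g h : e g h = e h g.
  suff : forall a b, e a b -> e b a by move=> i; apply/idP/idP; apply: i.
  by move=> a b /asboolP /UV; rewrite invgM invgK => ?; apply/asboolP.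
have etr g h k : e g h -> e h k -> e g k.
  move=> /asboolP a /asboolP b; apply/asboolP.
  by have := UM _ _ a b; rewrite mulgA -(mulgA _ h) mulgV mulg1.
suff [s hs] : exists s : seq G, forall g, count (e g) s = has (e g) t.
  by exists s => g; rewrite [LHS]hs /e ht.
elim: t {ht} => [|h t [s hs]]; first by exists [::].
have [hh|hh] := boolP (has (e h) t).
  exists s => g; rewrite hs /=; case gh: (e g h) => //=.
  case/hasP: hh => k kt hk; suff -> : has (e g) t by [].
  by apply/hasP; exists k => //; apply: etr gh hk.
exists (h :: s) => g /=; rewrite hs; case gh: (e g h) => //=.
suff /negbTE -> : ~~ has (e g) t by [].
apply: contra hh => /hasP [k kt gk]; apply/hasP; exists k => //.
by apply: etr gk; rewrite esym.
Qed.

Lemma Gal_open_finite U : Gal_open U -> exists r, coset_reps U r.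
Proof.
case=> sU [e eL hU]; have [r hr] := Gal_orbits eL.
pose pick v := xget (1%g : GalT K L) [set s : GalT K L | [seq s x | x <- e] = v].
apply: (transversal_of_cover (t := [seq pick v | v <- r])) => // g.
apply/hasP; exists (pick [seq g x | x <- e]); first exact: map_f.
apply/asboolP/hU => x xe.
have /eq_in_map h : [seq pick [seq g x | x <- e] x | x <- e] = [seq g x | x <- e].
  by apply: (@xgetPex _ _ [set s : GalT K L | [seq s x | x <- e] = _]); exists g.
by apply: (@Gal_inj g); rewrite /= GalV_funK h.
Qed.

End GalGroup.

Definition is_galois (K L : divringClosed algC) : Prop :=
  {subset K <= L} /\
  (forall x, x \in L -> (forall s : GalT K L, s x = x) -> x \in K).

Definition abelian_ext (K L : divringClosed algC) : Prop :=
  is_galois K L /\ forall s t : GalT K L, (s * t = t * s)%g.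

Definition abGal (K L : divringClosed algC) (hL : abelian_ext K L) : abTopGroup :=
  AbTopGroup hL.2 (@Gal_openT K L)
    (fun U (hU : Gal_open U) => hU.1) (@Gal_open_finite K L).

Definition has_degree (E F : divringClosed algC) (n : nat) : Prop :=
  {subset E <= F} /\
  exists b : 'I_n -> algC,
    [/\ forall i, b i \in F,
        forall x, x \in F ->
          exists2 c : 'I_n -> algC, (forall i, c i \in E) & x = \sum_i c i * b i &
        forall c : 'I_n -> algC, (forall i, c i \in E) ->
          \sum_i c i * b i = 0 -> forall i, c i = 0].

Definition finite_ext (E F : divringClosed algC) : Prop :=
  exists n, has_degree E F n.

Definition imaginary_quadratic (K : divringClosed algC) : Prop :=
  has_degree Crat K 2 /\ exists2 x, x \in K & x \notin Num.real.

Definition integers (F : divringClosed algC) : set algC :=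
  [set x | x \in F /\ x \in Aint].

Definition is_prime (F : divringClosed algC) (P : set algC) : Prop :=
  [/\ P `<=` integers F,
      P 0 /\ (forall x y, P x -> P y -> P (x + y)),
      forall a x, integers F a -> P x -> P (a * x),
      ~ P 1 /\ (exists2 x, P x & x != 0) &
      forall x y, integers F x -> integers F y -> P (x * y) -> P x \/ P y].

Definition ideal_mul (P Q : set algC) : set algC :=
  [set x | exists s : seq (algC * algC),
     (forall a, a \in s -> P a.1 /\ Q a.2) /\ x = \sum_(a <- s) a.1 * a.2].

Definition splits_as (p : nat) (F : divringClosed algC) (P Q : set algC) : Prop :=
  [/\ is_prime F P, is_prime F Q, P <> Q &
      [set p%:R * x | x in integers F] = ideal_mul P Q].

(* An imaginary quadratic field has exactly one archimedean place. *)
Variant place := FinitePlace of set algC | ArchimedeanPlace.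

Definition is_place (K : divringClosed algC) (v : place) : Prop :=
  if v is FinitePlace P then is_prime K P else True.

Definition above (p : nat) (v : place) : Prop :=
  if v is FinitePlace P then P p%:R else False.

Definition inertia (E F : divringClosed algC) (Q : set algC) : set (GalT E F) :=
  [set s | forall x, integers F x -> Q (s x - x)].

(* The place v of K ramifies in the (possibly infinite) Galois extension F/E,
   where K <= E: some prime of F above v has nontrivial inertia group in
   Gal(F/E).  The archimedean place is complex, hence never ramifies. *)
Definition ramified (K E F : divringClosed algC) (v : place) : Prop :=
  if v is FinitePlace P then
    exists Q : set algC, [/\ is_prime F Q, P = [set x | Q x /\ x \in K] &
      exists2 s : GalT E F, inertia Q s & s <> 1%g]
  else False.

(* The subgroup H of Gal(L/K), with the Krull topology, is isomorphic to Z_p^2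
   as a topological group; H is assumed open. *)
Definition iso_Zp2 (p : nat) (K L : divringClosed algC) (H : set (GalT K L)) : Prop :=
  exists f : padic p * padic p -> GalT K L,
    [/\ injective f, range f = H,
        forall x y, f (x + y) = (f x * f y)%g,
        forall n, Gal_open [set f (p%:R ^+ n * x.1, p%:R ^+ n * x.2) | x in setT] &
        forall U, Gal_open U ->
          exists n, forall x, U (f (p%:R ^+ n * x.1, p%:R ^+ n * x.2))].

Definition Zp2_extension (p : nat) (K F : divringClosed algC) : Prop :=
  is_galois K F /\ iso_Zp2 p [set: GalT K F].

Definition ab_pro_p_unram (p : nat) (K L M : divringClosed algC)
    (Sigma0 : set place) : Prop :=
  [/\ abelian_ext L M,
      forall U : set (GalT L M), Gal_open U ->
        exists s k, coset_reps U s /\ size s = (p ^ k)%N &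
      forall v, is_place K v -> ~ Sigma0 v -> ~ ramified K L M v].

Definition max_ab_pro_p_unram (p : nat) (K L M : divringClosed algC)
    (Sigma0 : set place) : Prop :=
  ab_pro_p_unram p K L M Sigma0 /\
  forall M' : divringClosed algC, ab_pro_p_unram p K L M' Sigma0 ->
    {subset M' <= M}.

(* X is the Z_p[[Gal(L/K)]]-module Gal(M/L): the additive group X is identified
   with Gal(M/L) by f, the class of g acts by conjugation by any lift of g to
   Gal(M/K), and the action is continuous in the scalar (which determines it,
   since Z[Gal(L/K)] is dense in Z_p[[Gal(L/K)]]). *)
Definition is_Galois_module (p : nat) (K L M : divringClosed algC)
    (hL : abelian_ext K L) (X : lmodType (iwasawa p (abGal hL))) : Prop :=
  exists f : X -> GalT L M,
    [/\ bijective f,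
        forall x y, f (x + y) = (f x * f y)%g,
        forall (g : GalT K L) (h : GalT K M), {in L, g =1 h} ->
          forall x z, z \in M ->
            f (group_elt p (g : abGal hL) *: x) (h z) = h (f x z) &
        forall x (N : set (GalT L M)), Gal_open N ->
          exists n (U : openSub (abGal hL)), forall a : iwasawa p (abGal hL),
            (forall g, exists b, a U g = p%:R ^+ n * b) -> N (f (a *: x))].

Definition trivial_Zp (p : nat) (G : abTopGroup) : Type := padic p.
HB.instance Definition _ p G := GRing.Zmodule.on (trivial_Zp p G).

Section TrivialZp.
Variables (p : nat) (G : abTopGroup).

(* The coefficient in Z_p[G/G] = Z_p. *)
Definition augmentation (a : iwasawa p G) : padic p := a (openSubT G) 1%g.

Lemma augmentation1 : augmentation 1 = 1.
Proof. by rewrite /augmentation /=; have /asboolP -> : [set: G] (1^-1 * 1)%g by []. Qed.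

Lemma augmentationM (a b : iwasawa p G) :
  augmentation (a * b) = augmentation a * augmentation b.
Proof.
rewrite /augmentation /=.
rewrite -[RHS](@sum_sameco p G (openSubT G) _ 1%g _ (transvP (openSubT G))).
rewrite [RHS]big_mkcond; apply: eq_bigr => h _.
have eT g g' : sameco (openSubT G) g g' by apply/asboolP.
by rewrite eT; congr (_ * _); apply: iwasawa_invar.
Qed.

Definition trivial_scale (a : iwasawa p G) (x : trivial_Zp p G) : trivial_Zp p G :=
  augmentation a * (x : padic p).

Lemma trivial_scaleA a b x :
  trivial_scale a (trivial_scale b x) = trivial_scale (a * b) x.
Proof. by rewrite /trivial_scale mulrA augmentationM. Qed.
Lemma trivial_scale1 : left_id 1 trivial_scale.
Proof. by move=> x; rewrite /trivial_scale augmentation1 mul1r. Qed.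
Lemma trivial_scaleDr : right_distributive trivial_scale +%R.
Proof. by move=> a x y; apply: mulrDr. Qed.
Lemma trivial_scaleDl x : {morph trivial_scale^~ x : a b / a + b}.
Proof. by move=> a b; apply: mulrDl. Qed.
HB.instance Definition _ := GRing.Zmodule_isLmodule.Build (iwasawa p G)
  (trivial_Zp p G) trivial_scaleA trivial_scale1 trivial_scaleDr trivial_scaleDl.
End TrivialZp.

(* For a closed subgroup H of G, the image of Z_p[[H]] in Z_p[[G]]: the elements
   whose coefficients at the cosets not meeting H vanish. *)
Definition iwasawa_sub (p : nat) (G : abTopGroup) (H : set G) : set (iwasawa p G) :=
  [set x | forall (U : openSub G) g,
     (forall h, H h -> ~ U (g^-1 * h)%g) -> x U g = 0].

(* The denominators are the finite products of elements of S; this is S itself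
   when S is multiplicative. *)
Definition denominator (R : comNzRingType) (S : set R) (d : R) : Prop :=
  exists2 s : seq R, (forall x, x \in s -> S x) & d = \prod_(x <- s) x.

Record fraction_pair (R : comNzRingType) (S : set R) := FractionPair {
  fp_num : R; fp_den : R; fp_denP : denominator S fp_den }.

HB.instance Definition _ R S := gen_eqMixin (@fraction_pair R S).
HB.instance Definition _ R S := gen_choiceMixin (@fraction_pair R S).

Section Localization.
Variables (R : comNzRingType) (S : set R).
Local Notation fp := (fraction_pair S).
Implicit Types x y z : fp.

Lemma denominator1 : denominator S 1.
Proof. by exists [::]; rewrite ?big_nil. Qed.
Lemma denominatorM a b : denominator S a -> denominator S b -> denominator S (a * b).
Proof.
case=> s hs -> [t ht ->]; exists (s ++ t); rewrite ?big_cat // => x.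
by rewrite mem_cat => /orP[/hs|/ht].
Qed.

Definition fp_eq x y : Prop := exists2 u, denominator S u &
  u * (fp_num x * fp_den y - fp_num y * fp_den x) = 0.
Definition fp_eqb x y : bool := `[< fp_eq x y >].

Lemma fp_eqb_refl : reflexive fp_eqb.
Proof. by move=> x; apply/asboolP; exists 1; [apply: denominator1|rewrite subrr mulr0]. Qed.
Lemma fp_eqb_sym : symmetric fp_eqb.
Proof.
suff h x y : fp_eqb x y -> fp_eqb y x by move=> x y; apply/idP/idP; apply: h.
case/asboolP=> u hu e; apply/asboolP; exists u => //.
by rewrite -opprB mulrN e oppr0.
Qed.
Lemma fp_eqb_trans : transitive fp_eqb.
Proof.
move=> y x z /asboolP[u hu e] /asboolP[v hv e']; apply/asboolP.
exists (u * v * fp_den y).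
  by apply: denominatorM (fp_denP y); apply: denominatorM.
transitivity (v * fp_den z * (u * (fp_num x * fp_den y - fp_num y * fp_den x))
  + u * fp_den x * (v * (fp_num y * fp_den z - fp_num z * fp_den y))); first by ring.
by rewrite e e' !mulr0 addr0.
Qed.

Canonical fp_equiv := EquivRel fp_eqb fp_eqb_refl fp_eqb_sym fp_eqb_trans.

Definition localization := {eq_quot fp_eqb}.
HB.instance Definition _ := Choice.on localization.
HB.instance Definition _ := Quotient.on localization.
HB.instance Definition _ : EqQuotient _ fp_eqb localization := EqQuotient.on localization.

Definition fp_zero : fp := FractionPair 0 denominator1.
Definition fp_one : fp := FractionPair 1 denominator1.
Definition fp_opp x : fp := FractionPair (- fp_num x) (fp_denP x).
Definition fp_add x y : fp :=
  FractionPair (fp_num x * fp_den y + fp_num y * fp_den x)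
    (denominatorM (fp_denP x) (fp_denP y)).
Definition fp_mul x y : fp :=
  FractionPair (fp_num x * fp_num y) (denominatorM (fp_denP x) (fp_denP y)).

Local Notation "\p x" := (\pi_localization x) (at level 10).

Lemma loc_eq x y : fp_eq x y -> \p x = \p y.
Proof. by move=> h; apply/eqmodP/asboolP. Qed.
Lemma loc_eqE x y : \p x = \p y -> fp_eq x y.
Proof. by move/eqmodP/asboolP. Qed.
Lemma loc_reprE x : fp_eq (repr (\p x)) x.
Proof. by apply: loc_eqE; rewrite reprK. Qed.
Lemma loc_eq1 x y :
  fp_num x * fp_den y = fp_num y * fp_den x -> \p x = \p y.
Proof. by move=> e; apply: loc_eq; exists 1; [apply: denominator1|rewrite e subrr mulr0]. Qed.

Definition loc_opp (a : localization) : localization := \p (fp_opp (repr a)).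
Definition loc_add (a b : localization) : localization :=
  \p (fp_add (repr a) (repr b)).
Definition loc_mul (a b : localization) : localization :=
  \p (fp_mul (repr a) (repr b)).

Lemma loc_oppE x : loc_opp (\p x) = \p (fp_opp x).
Proof.
have [u hu e] := loc_reprE x; apply: loc_eq; exists u => //=.
by rewrite -[RHS]oppr0 -e; ring.
Qed.
Lemma loc_addE x y : loc_add (\p x) (\p y) = \p (fp_add x y).
Proof.
have [u hu e] := loc_reprE x; have [v hv e'] := loc_reprE y.
apply: loc_eq; exists (u * v); first exact: denominatorM.
move: (repr (\p x)) (repr (\p y)) e e' => x' y' e e' /=.
transitivity (v * fp_den y * fp_den y' * (u * (fp_num x' * fp_den x - fp_num x * fp_den x'))
 + u * fp_den x * fp_den x' * (v * (fp_num y' * fp_den y - fp_num y * fp_den y'))).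
  by ring.
by rewrite e e' !mulr0 addr0.
Qed.
Lemma loc_mulE x y : loc_mul (\p x) (\p y) = \p (fp_mul x y).
Proof.
have [u hu e] := loc_reprE x; have [v hv e'] := loc_reprE y.
apply: loc_eq; exists (u * v); first exact: denominatorM.
move: (repr (\p x)) (repr (\p y)) e e' => x' y' e e' /=.
transitivity (v * fp_num y' * fp_den y * (u * (fp_num x' * fp_den x - fp_num x * fp_den x'))
 + u * fp_num x * fp_den x' * (v * (fp_num y' * fp_den y - fp_num y * fp_den y'))).
  by ring.
by rewrite e e' !mulr0 addr0.
Qed.

Lemma loc_addA : associative loc_add.
Proof.
elim/quotW=> x; elim/quotW=> y; elim/quotW=> z.
rewrite (loc_addE y z) (loc_addE x y) (loc_addE x) (loc_addE _ z).
by apply: loc_eq1 => /=; ring.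
Qed.
Lemma loc_addC : commutative loc_add.
Proof.
by elim/quotW=> x; elim/quotW=> y; rewrite (loc_addE x y) (loc_addE y x); apply: loc_eq1 => /=; ring.
Qed.
Lemma loc_add0 : left_id (\p fp_zero) loc_add.
Proof. by elim/quotW=> x; rewrite !loc_addE; apply: loc_eq1 => /=; ring. Qed.
Lemma loc_addN : left_inverse (\p fp_zero) loc_opp loc_add.
Proof.
by elim/quotW=> x; rewrite loc_oppE loc_addE; apply: loc_eq1 => /=; ring.
Qed.
HB.instance Definition _ := GRing.isZmodule.Build localization
  loc_addA loc_addC loc_add0 loc_addN.

Lemma loc_mulA : associative loc_mul.
Proof.
elim/quotW=> x; elim/quotW=> y; elim/quotW=> z.
rewrite (loc_mulE y z) (loc_mulE x y) (loc_mulE x) (loc_mulE _ z).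
by apply: loc_eq1 => /=; ring.
Qed.
Lemma loc_mulC : commutative loc_mul.
Proof.
by elim/quotW=> x; elim/quotW=> y; rewrite (loc_mulE x y) (loc_mulE y x); apply: loc_eq1 => /=; ring.
Qed.
Lemma loc_mul1 : left_id (\p fp_one) loc_mul.
Proof. by elim/quotW=> x; rewrite !loc_mulE; apply: loc_eq1 => /=; ring. Qed.
Lemma loc_mulD : left_distributive loc_mul +%R.
Proof.
elim/quotW=> x; elim/quotW=> y; elim/quotW=> z.
rewrite [_ + _](loc_addE x y) (loc_mulE _ z) (loc_mulE x z) (loc_mulE y z).
rewrite [RHS]loc_addE.
by apply: loc_eq1 => /=; ring.
Qed.
HB.instance Definition _ := GRing.Zmodule_isComPzRing.Build localization
  loc_mulA loc_mulC loc_mul1 loc_mulD.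

Definition to_loc (r : R) : localization := \p (FractionPair r denominator1).

End Localization.

Definition Rspan (R : comNzRingType) (S : set R) (A : set (localization S)) :
    set (localization S) :=
  [set x | exists s : seq (R * localization S),
     (forall a, a \in s -> A a.2) /\ x = \sum_(a <- s) to_loc S a.1 * a.2].

Record Omega (R : comNzRingType) (S : set R) := MkOmega {
  Omega_set : set (localization S);
  OmegaP : exists g : seq (localization S), Omega_set = Rspan [set` g] }.

HB.instance Definition _ R S := gen_eqMixin (@Omega R S).
HB.instance Definition _ R S := gen_choiceMixin (@Omega R S).

Section OmegaOps.
Variables (R : comNzRingType) (S : set R).
Implicit Types (I J : Omega S) (A B : set (localization S)).

Lemma to_loc1 : to_loc S 1 = 1. Proof. by []. Qed.
Lemma to_locM a b : to_loc S (a * b) = to_loc S a * to_loc S b.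
Proof. by rewrite /to_loc [RHS]loc_mulE; apply: loc_eq1 => /=; ring. Qed.

Lemma span_sub A : A `<=` Rspan A.
Proof.
move=> x Ax; exists [:: (1, x)]; rewrite big_seq1 to_loc1 mul1r; split=> // a.
by rewrite inE => /eqP ->.
Qed.
Lemma span0 A : Rspan A 0.
Proof. by exists [::]; rewrite big_nil. Qed.
Lemma spanD A x y : Rspan A x -> Rspan A y -> Rspan A (x + y).
Proof.
case=> s [hs ->] [t [ht ->]]; exists (s ++ t); rewrite big_cat; split=> // a.
by rewrite mem_cat => /orP[/hs|/ht].
Qed.
Lemma spanZ A r x : Rspan A x -> Rspan A (to_loc S r * x).
Proof.
case=> s [hs ->]; exists [seq (r * a.1, a.2) | a <- s]; split.
  by move=> _ /mapP[b /hs hb ->].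
by rewrite big_map big_distrr; apply: eq_bigr => a _ /=; rewrite to_locM mulrA.
Qed.
Lemma span_sum A (T : eqType) (s : seq T) (F : T -> localization S) :
  (forall a, a \in s -> Rspan A (F a)) -> Rspan A (\sum_(a <- s) F a).
Proof.
move=> h; rewrite big_seq; apply: (big_ind (Rspan A)) h; [exact: span0|exact: spanD].
Qed.
Lemma span_le A B : A `<=` Rspan B -> Rspan A `<=` Rspan B.
Proof.
by move=> AB x [s [hs ->]]; apply: span_sum => a /hs /AB; apply: spanZ.
Qed.

Definition Omega_span (g : seq (localization S)) : Omega S :=
  MkOmega (ex_intro _ g (erefl (Rspan [set` g]))).

Definition Omega1 : Omega S := Omega_span [:: 1].
Definition Omega0 : Omega S := Omega_span [::].

Definition Omega_mul_set I J : set (localization S) :=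
  Rspan [set a * b | a in Omega_set I & b in Omega_set J].

Lemma Omega_mul_subproof I J :
  exists g : seq (localization S), Omega_mul_set I J = Rspan [set` g].
Proof.
have [g hg] := OmegaP I; have [h hh] := OmegaP J.
exists [seq a * b | a <- g, b <- h]; rewrite /Omega_mul_set hg hh.
apply/seteqP; split; apply: span_le; last first.
  move=> x /allpairsP[[a b] [/= ag bh ->]]; apply: span_sub.
  by exists a; [exact: span_sub|exists b => //; exact: span_sub].
move=> _ [a [s [hs ->]] [b [t [ht ->]] <-]].
rewrite big_distrl; apply: span_sum => u us; rewrite big_distrr.
apply: span_sum => v vt /=; rewrite mulrACA -to_locM; apply: spanZ.
by apply/span_sub/allpairsP; exists (u.2, v.2); split; [apply: hs|apply: ht|].
Qed.

Definition Omega_mul I J : Omega S := MkOmega (Omega_mul_subproof I J).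

(* The inverse of an invertible element of Omega; the junk value is [Omega0]. *)
Definition Omega_inv I : Omega S := xget Omega0 [set J | Omega_mul I J = Omega1].

End OmegaOps.

Section Modules.
Variable R : comNzRingType.

Definition surjective (A B : Type) (f : A -> B) : Prop := forall y, exists x, f x = y.

Definition exact_at (A B C : lmodType R) (f : A -> B) (g : B -> C) : Prop :=
  forall y, g y = 0 <-> exists x, f x = y.

Definition finitely_generated (M : lmodType R) : Prop :=
  exists s : seq M, forall x, exists c : 'I_(size s) -> R, x = \sum_i c i *: s`_i.

Definition projective (P : lmodType R) : Prop :=
  forall (A B : lmodType R) (f : {linear A -> B}) (g : {linear P -> B}),
    surjective f -> exists h : {linear P -> A}, forall x, f (h x) = g x.

Definition pd_le1 (P : lmodType R) : Prop :=
  exists (Q1 Q0 : lmodType R) (f : {linear Q1 -> Q0}) (g : {linear Q0 -> P}),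
    [/\ projective Q1 /\ projective Q0, injective f, exact_at f g & surjective g].

Variable S : set R.

Definition torsion (M : lmodType R) : Prop :=
  forall x : M, exists2 s, S s & s *: x = 0.

(* With R = Z_p[[G]] and S = Z_p[[G']] minus 0, [in_M] and [in_P] are membership
   in the categories M and P. *)
Definition in_M (M : lmodType R) : Prop := finitely_generated M /\ torsion M.

Definition in_P (P : lmodType R) : Prop := in_M P /\ pd_le1 P.

Definition short_exact (A B C : lmodType R) : Prop :=
  exists (f : {linear A -> B}) (g : {linear B -> C}),
    [/\ injective f, exact_at f g & surjective g].

Definition resolution (N P1 P2 M : lmodType R)
    (f : {linear N -> P1}) (g : {linear P1 -> P2}) (h : {linear P2 -> M}) : Prop :=
  [/\ [/\ in_M N, in_P P1, in_P P2 & in_M M],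
      injective f, exact_at f g, exact_at g h & surjective h].

(* R^b --A--> R^a -> M -> 0 is exact, with column vectors. *)
Definition presents (M : lmodType R) (a b : nat) (A : 'M[R]_(a, b)) : Prop :=
  exists q : {linear 'cV[R]_a -> M},
    surjective q /\
    forall v, q v = 0 <-> exists w : 'cV[R]_b, A *m w = v.

(* The ideal generated by the a x a minors of A, inside S^-1 R. *)
Definition minors_ideal (a b : nat) (A : 'M[R]_(a, b)) : Omega S :=
  Omega_span [seq to_loc S (\det (colsub f A)) | f : {ffun 'I_a -> 'I_b}].

(* By Fitting's lemma the ideal does not depend on the presentation.  The junk
   value for modules without finite presentation is 0. *)
Definition Fitt (M : lmodType R) : Omega S :=
  xget (Omega0 S) [set I | exists a b (A : 'M[R]_(a, b)),
    presents M A /\ I = minors_ideal A].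

Record Pobj := MkPobj { Pobj_mod :> lmodType R; PobjP : in_P Pobj_mod }.

(* (s, t) stands for the formal difference of the sums of the classes in s, t. *)
Definition formal := (seq Pobj * seq Pobj)%type.

(* The congruence presenting the abelian group generated by the [P] with the
   relations [B] = [A] + [C] for short exact sequences. *)
Inductive K0_eq : formal -> formal -> Prop :=
| K0_refl x : K0_eq x x
| K0_sym x y : K0_eq x y -> K0_eq y x
| K0_trans x y z : K0_eq x y -> K0_eq y z -> K0_eq x z
| K0_add x y x' y' : K0_eq x y -> K0_eq x' y' ->
    K0_eq (x.1 ++ x'.1, x.2 ++ x'.2) (y.1 ++ y'.1, y.2 ++ y'.2)
| K0_comm x y : K0_eq (x.1 ++ y.1, x.2 ++ y.2) (y.1 ++ x.1, y.2 ++ x.2)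
| K0_cancel P : K0_eq ([:: P], [:: P]) ([::], [::])
| K0_exact (A B C : Pobj) : short_exact A B C ->
    K0_eq ([:: B], [::]) ([:: A; C], [::]).

Record K0 := MkK0 {
  K0_class : formal -> Prop;
  K0P : exists x, K0_class = K0_eq x }.

Definition K0_of (x : formal) : K0 := MkK0 (ex_intro _ x (erefl (K0_eq x))).

Definition K0_diff (P1 P2 : lmodType R) (h1 : in_P P1) (h2 : in_P P2) : K0 :=
  K0_of ([:: MkPobj h1], [:: MkPobj h2]).

Definition Fitt_seq (s : seq Pobj) : Omega S :=
  foldr (fun (P : Pobj) I => Omega_mul (Fitt P) I) (Omega1 S) s.

(* The homomorphism K_0(P) -> Omega^* induced by Fitt, computed on any
   representative of the class. *)
Definition Fitt_K0 (x : K0) : Omega S :=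
  xget (Omega0 S) [set I | exists2 y, K0_class x y &
    I = Omega_mul (Fitt_seq y.1) (Omega_inv (Fitt_seq y.2))].

(* The value does not depend on the resolution; the junk value for modules
   without a resolution is 0. *)
Definition Fitt2 (M : lmodType R) : Omega S :=
  xget (Omega0 S) [set I | exists (N P1 P2 : lmodType R)
      (f : {linear N -> P1}) (g : {linear P1 -> P2}) (h : {linear P2 -> M}),
    resolution f g h /\
    I = Omega_mul (Omega_mul (Omega_inv (Fitt P1)) (Fitt P2)) (Fitt N)].

End Modules.

(* Main.v *)
(* Let S be a set of nonzerodivisors of a commutative ring R. A module P in the
   category P has, for suitable matrices, a presentation A with A B = s and B A
   divisible by s, for some product s of elements of S (dual basis lemma applied
   to the kernel of R^a -> P, which contains s R^a). By Cauchy-Binet the maximal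
   minors of A and of B generate ideals with product (s^a), so Fitt(P) is
   invertible, and over S^-1 R the block triangular presentation of an extension
   of P becomes block diagonal, so that Fitt is multiplicative on short exact
   sequences ending in P. Two resolutions of the same module are compared by
   pulling both back along a common cover (R/s)^n, followed by a fibre product
   over the common first syzygy. This makes F^[2] independent of the resolution,
   and the theorem is its value on the resolution given by X.
   It remains to see that nonzero elements x of Z_p[[G']] are regular in
   Z_p[[G]]. After division by powers of p one works in F_p[G/U]: a power x^(p^n)
   has support in (G')^(p^n), while an element supported there with nonzero
   augmentation has a p-power that is a nonzero constant, hence is a unit. *)
Require Import Defs.
From HB Require Import structures.
From mathcomp Require Import all_boot all_order all_algebra all_field.
From mathcomp Require Import perm ssrAC generic_quotient.
From mathcomp Require Import boolp classical_sets cardinality.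
From mathcomp Require Import ring.
From mathcomp Require freeg.

Set Implicit Arguments.
Unset Strict Implicit.
Unset Printing Implicit Defensive.

Import GRing.Theory.
Local Open Scope ring_scope.
Local Open Scope quotient_scope.
Local Open Scope classical_set_scope.

(** * Maximal minors *)

Section Minors.
Variable R : comNzRingType.

(** A bare predicate, because it is applied to conditions on [x : R] saying that [y x] lies in [I],
    for [I] in [Omega] and [y] a fraction. *)
Definition ideal_like (J : R -> Prop) : Prop :=
  [/\ J 0, forall x y, J x -> J y -> J (x + y) & forall r x, J x -> J (r * x)].

Lemma ideal_like_sum J (I : Type) (s : seq I) (Q : pred I) (F : I -> R) :
  ideal_like J -> (forall i, Q i -> J (F i)) -> J (\sum_(i <- s | Q i) F i).
Proof. by case=> J0 JD _ h; apply: (big_ind J). Qed.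

(** Column [i] of [A *m B] is the combination of the columns of [A] with coefficients [B j i]; the
    determinant is expanded multilinearly. Non-injective [f] are kept, their terms being zero. *)
Lemma det_mulmx_rect a b (A : 'M[R]_(a, b)) (B : 'M[R]_(b, a)) :
  \det (A *m B) =
  \sum_(f : {ffun 'I_a -> 'I_b}) \det (colsub f A) * \prod_i B (f i) i.
Proof.
rewrite -det_tr.
transitivity (\sum_(f : {ffun 'I_a -> 'I_b}) \sum_(s : 'S_a)
    (-1) ^+ s * \prod_i (A (s i) (f i) * B (f i) i)).
  rewrite exchange_big; apply: eq_bigr => /= s _; rewrite -big_distrr /=.
  congr (_ * _); rewrite -(bigA_distr_bigA (fun i j => A (s i) j * B j i)) /=.
  by apply: eq_bigr => x _; rewrite !mxE.
apply: eq_bigr => f _; rewrite -det_tr big_distrl; apply: eq_bigr => s _ /=.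
rewrite big_split /= mulrA; congr (_ * _ * _).
by apply: eq_bigr => i _; rewrite !mxE.
Qed.

Lemma det_mulmx_minors J a b (A : 'M[R]_(a, b)) (B : 'M[R]_(b, a)) :
  ideal_like J -> (forall f : {ffun 'I_a -> 'I_b}, J (\det (colsub f A))) ->
  J (\det (A *m B)).
Proof.
move=> hJ h; rewrite det_mulmx_rect; apply: ideal_like_sum => // f _.
by case: hJ => _ _ JM; rewrite mulrC; apply: JM.
Qed.

Lemma colsub_noninj a b (A : 'M[R]_(a, b)) (f : {ffun 'I_a -> 'I_b}) :
  ~~ injectiveb f -> \det (colsub f A) = 0.
Proof.
case/injectivePn => i1 [i2 Di12 Ef12].
by rewrite -det_tr (determinant_alternate Di12) // => j; rewrite !mxE Ef12.
Qed.

(* The terms of [det_mulmx_rect] are grouped by the image of f: the injections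
   with a given image form one orbit of the symmetric group. *)
Lemma cauchy_binet_mem J a b (A : 'M[R]_(a, b)) (B : 'M[R]_(b, a)) :
  ideal_like J ->
  (forall f : {ffun 'I_a -> 'I_b}, J (\det (colsub f A) * \det (rowsub f B))) ->
  J (\det (A *m B)).
Proof.
move=> hJ h; rewrite det_mulmx_rect (bigID (fun f : {ffun 'I_a -> 'I_b} => injectiveb f)) /= addrC.
rewrite big1 ?add0r; last by move=> f /colsub_noninj ->; rewrite mul0r.
rewrite (partition_big (fun f : {ffun 'I_a -> 'I_b} => f @: [set: 'I_a]%SET) xpredT) //=.
apply: ideal_like_sum => // T _.
have [f0 /andP[/injectiveP f0i /eqP f0T]|none] := pickP
  (fun f : {ffun 'I_a -> 'I_b} => injectiveb f && (f @: [set: 'I_a]%SET == T)); last first.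
  by rewrite big_pred0 //; case: hJ.
suff -> : \sum_(f : {ffun 'I_a -> 'I_b} | injectiveb f && (f @: [set: 'I_a]%SET == T))
    \det (colsub f A) * \prod_i B (f i) i = \det (colsub f0 A) * \det (rowsub f0 B).
  exact: h.
(* By [cd] and [ci], [c] is a bijection from the permutations onto the injections with the same
   image as [f0]. *)
pose c (s : 'S_a) : {ffun 'I_a -> 'I_b} := [ffun i => f0 (s i)].
have cE s i : c s i = f0 (s i) by rewrite ffunE.
have cd (f : {ffun 'I_a -> 'I_b}) : injectiveb f && (f @: [set: 'I_a]%SET == T) ->
    exists s, c s = f.
  case/andP=> /injectiveP fi /eqP fT.
  have ex i : exists j, f0 j == f i.
    have : f i \in f0 @: [set: 'I_a]%SET by rewrite f0T -fT imset_f.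
    by case/imsetP => j _ ->; exists j.
  pose g i := xchoose (ex i).
  have gE i : f0 (g i) = f i := eqP (xchooseP (ex i)).
  have gi : injective g by move=> i j e; apply: fi; rewrite -!gE e.
  by exists (perm gi); apply/ffunP => i; rewrite cE permE gE.
have ci : injective c.
  by move=> s t /ffunP e; apply/permP => i; have := e i; rewrite !cE => /f0i.
rewrite (reindex c) /=; last first.
  exists (fun f => odflt 1%g [pick s | c s == f]).
    by move=> s _; case: pickP => [t /eqP /ci //|/(_ s)]; rewrite eqxx.
  move=> f /cd [s <-]; case: pickP => [t /eqP //|/(_ s)]; by rewrite eqxx.
rewrite (eq_bigl xpredT); last first.
  move=> s; apply/andP; split.
    by apply/injectiveP => i j; rewrite !cE => /f0i /perm_inj.
  rewrite -f0T; apply/eqP/setP => x; apply/imsetP/imsetP => -[i _ ->].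
    by exists (s i) => //; rewrite cE.
  by exists (s^-1 i)%g; rewrite ?inE ?cE ?permKV.
rewrite -(det_tr (rowsub f0 B)) [in RHS]big_distrr; apply: eq_bigr => s _ /=.
have -> : colsub (c s) A = colsub s (colsub f0 A).
  by apply/matrixP => i j; rewrite !mxE cE.
(* Permuting the columns by [s] contributes a sign, which completes the product of entries of [B] to
   a Leibniz term of the minor of [B]. *)
have -> : colsub s (colsub f0 A) = (row_perm s (colsub f0 A)^T)^T.
  by apply/matrixP => i j; rewrite !mxE.
rewrite det_tr row_permE det_mulmx det_perm det_tr [RHS]mulrCA [RHS]mulrA.
congr (_ * _ * _).
by apply: eq_bigr => i _; rewrite !mxE cE.
Qed.

(* Laplace expansion along the rows outside the image of r. *)
Lemma det_minors_mem J a n (r : 'I_a -> 'I_n) (A : 'M[R]_n) :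
  ideal_like J -> injective r ->
  (forall f : 'I_a -> 'I_n, J (\det (mxsub r f A))) -> J (\det A).
Proof.
move=> hJ; elim: n r A => [|n IH] r A ri h.
  have a0 : a = 0%N by case: a r ri h => // a r; have := r ord0; case.
  subst a; have := h r; by rewrite !det_mx00.
have [i hi|all_r] := pickP [pred i | [forall k, r k != i]]; last first.
  have {}all_r i : exists k, r k = i.
    by have := all_r i; rewrite /= => /negbT; rewrite negb_forall => /existsP[k /negPn/eqP]; exists k.
  have ea : a = n.+1.
    apply/eqP; rewrite eqn_leq; apply/andP; split.
      by have := leq_card r ri; rewrite !card_ord.
    rewrite -[X in (X <= _)%N]card_ord -[X in (_ <= X)%N]card_ord.
    rewrite -(card_codom ri); apply: subset_leq_card; apply/fintype.subsetP => i _.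
    by have [k <-] := all_r i; apply: codom_f.
  subst a; have := h r.
  (* Here [r] is onto, and the minor with [f = r] permutes the rows and the columns of [A] alike, so
     the two signs cancel. *)
  have -> : mxsub r r A = row_perm (perm ri) (col_perm (perm ri) A).
    by apply/matrixP => i j; rewrite !mxE !permE.
  by rewrite row_permE col_permE !det_mulmx !det_perm odd_permV mulrCA -signr_addb addbb mulr1.
move/forallP: hi => hi; rewrite (expand_det_row _ i).
apply: ideal_like_sum => // j _; case: (hJ) => _ _ JM; apply: (JM); apply: JM.
have ex k : exists l, lift i l == r k.
  have := hi k; rewrite eq_sym => /unlift_some [l -> _]; by exists l.
(* [r'] is [r] after deletion of row [i]; a minor of the cofactor on the rows [r'] is a minor of [A]
   on the rows [r]. *)
pose r' k := xchoose (ex k).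
have r'E k : lift i (r' k) = r k := eqP (xchooseP (ex k)).
apply: (IH r'); first by move=> k l e; apply: ri; rewrite -!r'E e.
move=> f; have := h (fun k => lift j (f k)).
congr (J (\det _)); apply/matrixP => k l; by rewrite !mxE r'E.
Qed.

Lemma det_col_mx_minors J a b c (U : 'M[R]_(c, c + a)) (A : 'M[R]_(a, b))
    (V : 'M[R]_(b, c + a)) : ideal_like J ->
  (forall f : {ffun 'I_a -> 'I_b}, J (\det (colsub f A))) ->
  J (\det (col_mx U (A *m V))).
Proof.
move=> hJ h; apply: (det_minors_mem (r := @rshift c a)) => //.
  exact: rshift_inj.
move=> f; have -> : mxsub (@rshift c a) f (col_mx U (A *m V)) = A *m colsub f V.
  by apply/matrixP => i j; rewrite !mxE (unsplitK (inr i)) !mxE; apply: eq_bigr => k _; rewrite !mxE.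
exact: det_mulmx_minors.
Qed.

Lemma det_col_mx_minors_up J a b c (A : 'M[R]_(a, b)) (V : 'M[R]_(b, a + c))
    (U : 'M[R]_(c, a + c)) : ideal_like J ->
  (forall f : {ffun 'I_a -> 'I_b}, J (\det (colsub f A))) ->
  J (\det (col_mx (A *m V) U)).
Proof.
move=> hJ h; apply: (det_minors_mem (r := @lshift a c)) => //.
  exact: lshift_inj.
move=> f; have -> : mxsub (@lshift a c) f (col_mx (A *m V) U) = A *m colsub f V.
  by apply/matrixP => i j; rewrite !mxE (unsplitK (inl i)) !mxE; apply: eq_bigr => k _; rewrite !mxE.
exact: det_mulmx_minors.
Qed.

End Minors.

(** * The monoid Omega and Fitting's lemma *)

Section OmegaTheory.
Variables (R : comNzRingType) (S : set R).
Implicit Types (I J K : Omega S).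

Lemma to_locD a b : to_loc S (a + b) = to_loc S a + to_loc S b.
Proof. by rewrite /to_loc [RHS]loc_addE; apply: loc_eq1; rewrite /= !mulr1. Qed.

Lemma to_loc0 : to_loc S 0 = 0. Proof. by []. Qed.

Lemma to_loc_inv s : denominator S s -> exists v, v * to_loc S s = 1.
Proof.
move=> ds; exists (\pi_(localization S)%qT (FractionPair 1 ds)).
by rewrite /to_loc [LHS]loc_mulE; apply: loc_eq1; rewrite /= !mulr1 mul1r.
Qed.

Lemma to_loc_invX v s n : v * to_loc S s = 1 -> v ^+ n * to_loc S (s ^+ n) = 1.
Proof.
move=> vs; elim: n => [|n IH]; first by rewrite mul1r to_loc1.
by rewrite !exprS to_locM mulrACA vs IH mulr1.
Qed.

Lemma Omega_ext I J :
  Omega_set I `<=` Omega_set J -> Omega_set J `<=` Omega_set I -> I = J.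
Proof.
move=> h1 h2; have {h1 h2} := conj h1 h2; rewrite -eqEsubset.
case: I J => [I hI] [J hJ] /= e; move: hI hJ; rewrite e => hI hJ.
by rewrite (Prop_irrelevance hI hJ).
Qed.

Lemma Omega_set0 I : Omega_set I 0.
Proof. by have [g ->] := OmegaP I; apply: span0. Qed.
Lemma Omega_setD I x y : Omega_set I x -> Omega_set I y -> Omega_set I (x + y).
Proof. by have [g ->] := OmegaP I; apply: spanD. Qed.
Lemma Omega_setZ I r x : Omega_set I x -> Omega_set I (to_loc S r * x).
Proof. by have [g ->] := OmegaP I; apply: spanZ. Qed.
Lemma Omega_span_le A I : A `<=` Omega_set I -> Rspan A `<=` Omega_set I.
Proof. by have [g ->] := OmegaP I; apply: span_le. Qed.

(** The factor [y] carries powers of the inverse of [s], so that the determinant lemmas over [R]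
    yield memberships in fractional ideals. *)
Lemma Omega_ideal_like I y : ideal_like (fun x => Omega_set I (y * to_loc S x)).
Proof.
split; first by rewrite to_loc0 mulr0; apply: Omega_set0.
  by move=> a b ha hb; rewrite to_locD mulrDr; apply: Omega_setD.
by move=> r x hx; rewrite to_locM mulrCA; apply: Omega_setZ.
Qed.

Lemma Omega_mul_mem I J x y :
  Omega_set I x -> Omega_set J y -> Omega_set (Omega_mul I J) (x * y).
Proof. by move=> hx hy; apply: span_sub; exists x => //; exists y. Qed.

Lemma Omega_mul_le I J K :
  (forall x y, Omega_set I x -> Omega_set J y -> Omega_set K (x * y)) ->
  Omega_set (Omega_mul I J) `<=` Omega_set K.
Proof. by move=> h; apply: Omega_span_le => _ [x hx [y hy <-]]; apply: h. Qed.

Lemma Omega_mulC : commutative (@Omega_mul R S).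
Proof.
move=> I J; apply: Omega_ext; apply: Omega_mul_le => x y hx hy; rewrite mulrC;
  exact: Omega_mul_mem.
Qed.

Lemma Omega_mul_le3 I J K L :
  (forall x y z, Omega_set I x -> Omega_set J y -> Omega_set K z ->
    Omega_set L (x * y * z)) ->
  Omega_set (Omega_mul (Omega_mul I J) K) `<=` Omega_set L.
Proof.
move=> h; apply: Omega_mul_le => w z hw hz.
have [g eL] := OmegaP L; case: hw => s [hs ->]; rewrite big_distrl eL /=.
apply: span_sum => u us /=; rewrite -mulrA; apply: spanZ; rewrite -eL.
by have [x hx [y hy <-]] := hs u us; apply: h.
Qed.

Lemma Omega_mulA : associative (@Omega_mul R S).
Proof.
suff h I J K : Omega_set (Omega_mul (Omega_mul I J) K) `<=`
    Omega_set (Omega_mul I (Omega_mul J K)).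
  move=> I J K; apply: Omega_ext => //.
  by rewrite Omega_mulC (Omega_mulC J) [X in _ `<=` Omega_set X]Omega_mulC
     (Omega_mulC I J).
apply: Omega_mul_le3 => x y z hx hy hz; rewrite -mulrA.
by do 2 apply: Omega_mul_mem => //.
Qed.

Lemma Omega1_mem r : Omega_set (Omega1 S) (to_loc S r).
Proof.
by rewrite -[to_loc S r]mulr1; apply: spanZ; apply: span_sub; rewrite /= inE.
Qed.

Lemma Omega_mul1 : left_id (Omega1 S) (@Omega_mul R S).
Proof.
move=> I; apply: Omega_ext.
  apply: Omega_mul_le => x y [s [hs ->]] hy; rewrite big_distrl /=.
  have [g eI] := OmegaP I; rewrite eI; apply: span_sum => u /hs /=.
  by rewrite inE => /eqP ->; rewrite mulr1; apply: spanZ; rewrite -eI.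
by move=> x hx; rewrite -[x]mul1r; apply: Omega_mul_mem => //; apply: Omega1_mem 1.
Qed.

Lemma Omega_mul1r : right_id (Omega1 S) (@Omega_mul R S).
Proof. by move=> I; rewrite Omega_mulC Omega_mul1. Qed.

(** Serves the case of [Fitt_exact] in which [Fitt] takes its default value [Omega0]. *)
Lemma Omega_mul0 : left_zero (Omega0 S) (@Omega_mul R S).
Proof.
move=> I; apply: Omega_ext; last first.
  by apply: Omega_span_le => x; rewrite /= in_nil.
apply: Omega_mul_le => x y [s [hs ->]] _; rewrite big_seq big1 ?mul0r.
  exact: Omega_set0.
by move=> u /hs.
Qed.

HB.instance Definition _ := Monoid.isComLaw.Build (Omega S) (Omega1 S)
  (@Omega_mul R S) Omega_mulA Omega_mulC Omega_mul1.

Definition Omega_unit I := exists J, Omega_mul I J = Omega1 S.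

Lemma Omega_mulV I : Omega_unit I -> Omega_mul I (Omega_inv I) = Omega1 S.
Proof. exact: (@xgetPex _ (Omega0 S) [set J | Omega_mul I J = Omega1 S]). Qed.

Lemma Omega_mulIl I J K : Omega_unit I ->
  Omega_mul I J = Omega_mul I K -> J = K.
Proof.
case=> I' hI e; rewrite -[J]Omega_mul1 -[K]Omega_mul1 -hI (Omega_mulC I) -!Omega_mulA.
by rewrite e.
Qed.

Lemma Omega_unitM I J : Omega_unit I -> Omega_unit J -> Omega_unit (Omega_mul I J).
Proof.
move=> [I' hI] [J' hJ]; exists (Omega_mul I' J').
by rewrite Monoid.mulmACA /= hI hJ Omega_mul1.
Qed.

Lemma minors_mem a b (A : 'M[R]_(a, b)) (f : {ffun 'I_a -> 'I_b}) :
  Omega_set (minors_ideal S A) (to_loc S (\det (colsub f A))).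
Proof. by apply/span_sub/mapP; exists f => //; rewrite mem_enum. Qed.

Lemma minors_le a b (A : 'M[R]_(a, b)) I :
  (forall f : {ffun 'I_a -> 'I_b}, Omega_set I (to_loc S (\det (colsub f A)))) ->
  Omega_set (minors_ideal S A) `<=` Omega_set I.
Proof. by move=> h; apply: Omega_span_le => x /mapP[f _ ->]. Qed.

Lemma minors_ideal_like a b (A : 'M[R]_(a, b)) :
  let J x := Omega_set (minors_ideal S A) (1 * to_loc S x) in
  ideal_like J /\ forall f : {ffun 'I_a -> 'I_b}, J (\det (colsub f A)).
Proof.
split; first exact: Omega_ideal_like.
by move=> f; rewrite mul1r; apply: minors_mem.
Qed.

End OmegaTheory.

(** * Linear maps out of free modules *)

Section LinearMaps.
Variable R : comNzRingType.

Lemma linear_pack (U V : lmodType R) (f : U -> V) :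
  (forall a x y, f (a *: x + y) = a *: f x + f y) ->
  exists g : {linear U -> V}, forall x, g x = f x.
Proof.
move=> h; pose mx := GRing.isLinear.Build R U V *:%R f h.
pose g : {linear U -> V} := HB.pack f mx.
by exists g.
Qed.

Lemma cV_map (M : lmodType R) a (e : 'I_a -> M) :
  exists q : {linear 'cV[R]_a -> M}, forall v, q v = \sum_i v i 0 *: e i.
Proof.
apply: linear_pack => c x y; rewrite scaler_sumr -big_split /=.
by apply: eq_bigr => i _; rewrite !mxE scalerDl scalerA.
Qed.

Lemma cV_lin (M : lmodType R) a (q : {linear 'cV[R]_a -> M}) v :
  q v = \sum_i v i 0 *: q (delta_mx i 0).
Proof.
rewrite -[q _]/(q _) {1}(matrix_sum_delta v) linear_sum; apply: eq_bigr => i _.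
by rewrite linear_sum big_ord1 linearZ.
Qed.

Lemma mulmx_colE a b (A : 'M[R]_(a, b)) (v : 'cV[R]_b) :
  A *m v = \sum_i v i 0 *: col i A.
Proof.
apply/matrixP => i j; rewrite ord1 !mxE summxE; apply: eq_bigr => k _.
by rewrite !mxE mulrC.
Qed.

Lemma mulmx_delta a b (A : 'M[R]_(a, b)) i : A *m delta_mx i 0 = col i A.
Proof. by rewrite colE. Qed.

Lemma cV_ext a b (A B : 'M[R]_(a, b)) :
  (forall v : 'cV[R]_b, A *m v = B *m v) -> A = B.
Proof. by move=> h; apply/matrixP => i j; have := h (delta_mx j 0); rewrite !mulmx_delta => /matrixP/(_ i 0); rewrite !mxE. Qed.

Lemma cols_choice a b (Q : 'I_b -> 'cV[R]_a -> Prop) :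
  (forall j, exists v, Q j v) -> exists A : 'M[R]_(a, b), forall j, Q j (col j A).
Proof.
move=> h; exists (\matrix_(i, j) projT1 (cid (h j)) i 0) => j.
suff -> : col j (\matrix_(i, j) projT1 (cid (h j)) i 0) = projT1 (cid (h j)).
  exact: projT2 (cid (h j)).
by apply/matrixP => i k; rewrite ord1 !mxE.
Qed.

Lemma lift_mx (M : lmodType R) a b (q : {linear 'cV[R]_a -> M})
    (h : {linear 'cV[R]_b -> M}) :
  (forall v, exists u, q u = h v) -> exists C, forall v, q (C *m v) = h v.
Proof.
move=> hq; have [C hC] := cols_choice (fun j => hq (delta_mx j 0)).
exists C => v; rewrite mulmx_colE linear_sum cV_lin; apply: eq_bigr => i _.
by rewrite linearZ hC.
Qed.

Lemma ker_mx a b c (A : 'M[R]_(a, b)) (Z : 'M[R]_(a, c)) :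
  (forall v, exists w : 'cV_b, A *m w = Z *m v) -> exists V, A *m V = Z.
Proof.
move=> h; have [V hV] := cols_choice (fun j => h (delta_mx j 0)).
exists V; apply: cV_ext => v; rewrite -mulmxA [V *m v]mulmx_colE [Z *m v]mulmx_colE.
rewrite linear_sum; apply: eq_bigr => i _; rewrite linearZ /= hV mulmx_delta.
by [].
Qed.

End LinearMaps.

Section FittingLemma.
Variables (R : comNzRingType) (S : set R).

(** The columns of [H] are relations for the two generating families taken together: relations of
    [A] selected by [f], and expressions of the second family by the first. A unipotent matrix
    rewrites the lower rows in terms of the second family alone, where they become [A' *m V]; hence
    the determinant of [H], which is that of [Af], lies in the ideal of [A']. *)
Lemma minors_presents_le (M : lmodType R) a b a' b' (A : 'M[R]_(a, b))
    (A' : 'M[R]_(a', b')) : presents M A -> presents M A' ->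
  Omega_set (minors_ideal S A) `<=` Omega_set (minors_ideal S A').
Proof.
move=> [q [qs qk]] [q' [qs' qk']].
have [C hC] : exists C, forall v, q (C *m v) = q' v by apply: lift_mx => v; apply: qs.
have [C' hC'] : exists C, forall v, q' (C *m v) = q v by apply: lift_mx => v; apply: qs'.
apply: minors_le => f; pose Af := colsub f A.
pose H : 'M[R]_(a + a') := block_mx Af (- C) 0 1%:M.
have [V hV] : exists V, A' *m V = C' *m row_mx Af (- C) + row_mx 0 1%:M.
  apply: ker_mx => v; apply/qk'.
  rewrite -[v]vsubmxK mulmxDl -mulmxA !mul_row_col mul0mx add0r mul1mx mulNmx.
  rewrite linearD hC' linearB hC.
  have /qk -> : exists w : 'cV_b, A *m w = Af *m usubmx v.
    exists ((\matrix_(i, j) (f j == i)%:R) *m usubmx v); rewrite mulmxA; congr (_ *m _).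
    apply/matrixP => i j; rewrite !mxE (bigD1 (f j)) //= !mxE eqxx mulr1.
    by rewrite big1 ?addr0 // => k /negPf; rewrite !mxE eq_sym => ->; rewrite mulr0.
  by rewrite sub0r addNr.
have eH : block_mx 1%:M 0 C' 1%:M *m H = col_mx (row_mx Af (- C)) (A' *m V).
  by rewrite hV /H /block_mx mul_col_mx !mul_row_col !mul1mx mul0mx addr0.
have [hJ hm] := minors_ideal_like S A'.
have := det_col_mx_minors (row_mx Af (- C)) V hJ hm.
by rewrite -eH det_mulmx det_lblock !det1 det_ublock det1 !mul1r mulr1.
Qed.

Lemma Fitt_presents (M : lmodType R) a b (A : 'M[R]_(a, b)) :
  presents M A -> Fitt S M = minors_ideal S A.
Proof.
move=> hA; rewrite /Fitt; case: xgetP => [I _ [a' [b' [A' [hA' ->]]]]|/(_ (minors_ideal S A))[]].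
  by apply: Omega_ext; apply: minors_presents_le; eassumption.
by exists a, b, A.
Qed.

Lemma Fitt_npresents (M : lmodType R) :
  (forall a b (A : 'M[R]_(a, b)), ~ presents M A) -> Fitt S M = Omega0 S.
Proof.
by move=> h; rewrite /Fitt; case: xgetP => // I _ [a [b [A [/h]]]].
Qed.

End FittingLemma.

(** * Extensions and presentations *)

Section Modules.
Variable R : comNzRingType.

Definition finitely_presented (M : lmodType R) : Prop :=
  exists a b (A : 'M[R]_(a, b)), presents M A.

Lemma linear_factor (U A B : lmodType R) (i : {linear A -> B}) (u : {linear U -> B}) :
  injective i -> (forall x, exists y, i y = u x) ->
  exists v : {linear U -> A}, forall x, i (v x) = u x.
Proof.
move=> ii h.
have [f hf] : exists f : U -> A, forall x, i (f x) = u x.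
  by exists (fun x => projT1 (cid (h x))) => x; exact: projT2 (cid (h x)).
have [v hv] : exists v : {linear U -> A}, forall x, v x = f x.
  by apply: linear_pack => c x y; apply: ii; rewrite linearP !hf linearP.
by exists v => x; rewrite hv.
Qed.

Lemma cV_lift (A B : lmodType R) (g : {linear A -> B}) a (q : {linear 'cV[R]_a -> B}) :
  surjective g -> exists h : {linear 'cV[R]_a -> A}, forall v, g (h v) = q v.
Proof.
move=> gs; have [h hh] := cV_map (fun i => projT1 (cid (gs (q (delta_mx i 0))))).
exists h => v; rewrite hh linear_sum cV_lin; apply: eq_bigr => i _.
by rewrite linearZ (projT2 (cid (gs _))).
Qed.

Definition regular (s : R) : Prop := forall r, s * r = 0 -> r = 0.

Lemma regularX s n : regular s -> regular (s ^+ n).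
Proof.
by move=> hs; elim: n => [|n IH] r; rewrite ?mul1r // exprS -mulrA => /hs /IH.
Qed.

Lemma regular_scale_mx s m n (X Y : 'M[R]_(m, n)) :
  regular s -> s *: X = s *: Y -> X = Y.
Proof.
move=> hs e; apply/matrixP => i j; apply/eqP; rewrite -subr_eq0; apply/eqP/hs.
by move/matrixP/(_ i j): e; rewrite !mxE => e; rewrite mulrBr e subrr.
Qed.

(* For regular s: the kernel im A of R^a -> coker A is projective, E being the
   induced idempotent of R^b; A has the left quasi-inverse B up to s. *)
Definition projective_pair s a b (A : 'M[R]_(a, b)) (B : 'M[R]_(b, a)) (E : 'M[R]_b) :=
  A *m B = s%:M /\ B *m A = s *: E.

Lemma projective_pairE s a b (A : 'M[R]_(a, b)) B E : regular s ->
  projective_pair s A B E -> A *m E = A /\ E *m B = B.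
Proof.
move=> hs [AB BA]; split; apply: (regular_scale_mx hs).
  by rewrite scalemxAr -BA mulmxA AB mul_scalar_mx.
by rewrite scalemxAl -BA -mulmxA AB mul_mx_scalar.
Qed.

(** Together with [A *m E = A] this makes the kernel of [A] the image of [1%:M - E], hence finitely
    generated. *)
Lemma projective_pair_ker s a b (A : 'M[R]_(a, b)) B E (w : 'cV_b) : regular s ->
  projective_pair s A B E -> A *m w = 0 -> E *m w = 0.
Proof.
move=> hs [AB BA] e; apply: (regular_scale_mx hs).
by rewrite scaler0 scalemxAl -BA -mulmxA e mulmx0.
Qed.

(** Relations of [C], evaluated on generators lifted to [B], fall into the image of [A] and give the
    block [X]. Composition with [E] changes [X] only by relations of [A], since [A2 *m E = A2]; the
    resulting [X *m E = X] later permits the removal of [X] over the fraction ring. *)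
Lemma horseshoe s (A B C : lmodType R) (i : {linear A -> B}) (g : {linear B -> C})
    a' b' (A' : 'M[R]_(a', b')) a b (A2 : 'M[R]_(a, b)) B2 E :
  regular s -> injective i -> exact_at i g -> surjective g ->
  presents A A' -> presents C A2 -> projective_pair s A2 B2 E ->
  exists X, presents B (block_mx A' X 0 A2) /\ X *m E = X.
Proof.
move=> hs ii ig gs [q' [qs' qk']] [q [qs qk]] hE.
have [AE _] := projective_pairE hs hE.
have [beta hbeta] := cV_lift q gs.
have [C0 hC0] : exists C0, forall v, (i \o q') (C0 *m v) = (beta \o mulmx A2) v.
  apply: lift_mx => v.
  have /ig[x xE] : g (beta (A2 *m v)) = 0 by rewrite hbeta; apply/qk; exists v.
  by have [u qu] := qs' x; exists u; rewrite /= qu xE.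
pose X := - C0 *m E; exists X; split; last first.
  rewrite /X -mulmxA; congr (_ *m _); have [AB BA] := hE.
  by apply: (regular_scale_mx hs); rewrite scalemxAl -BA -mulmxA AE.
have hX v : i (q' (X *m v)) = - beta (A2 *m v).
  by rewrite /X -mulmxA mulNmx !linearN [i _]hC0 /= mulmxA AE.
have [qB hqB] : exists qB : {linear 'cV[R]_(a' + a) -> B},
    forall v, qB v = i (q' (usubmx v)) + beta (dsubmx v).
  apply: linear_pack => c x y; rewrite !linearP /= -addrACA scalerDr.
  by rewrite addrACA.
exists qB; split.
  move=> y; have [v hv] := qs (g y).
  have /ig[x hx] : g (y - beta v) = 0 by rewrite linearB hbeta hv subrr.
  have [u hu] := qs' x; exists (col_mx u v).
  by rewrite hqB col_mxKu col_mxKd hu hx subrK.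
move=> v; rewrite hqB -[v]vsubmxK; set u := usubmx v; set w := dsubmx v.
rewrite col_mxKu col_mxKd; split.
  move=> e; have /qk[y yE] : q w = 0.
    rewrite -hbeta -[beta w](addKr (i (q' u))) e addr0 linearN.
    by apply/eqP; rewrite oppr_eq0; apply/eqP/ig; exists (q' u).
  have /qk'[x xE] : q' (u - X *m y) = 0.
    by apply: ii; rewrite linear0 !linearB hX yE opprK.
  exists (col_mx x y); rewrite mul_block_col mul0mx add0r yE xE subrK.
  by [].
case=> w0; rewrite -[w0]vsubmxK mul_block_col mul0mx add0r => /eq_col_mx[<- <-].
rewrite !linearD /= hX.
have -> : q' (A' *m usubmx w0) = 0 by apply/qk'; exists (usubmx w0).
by rewrite linear0 add0r addNr.
Qed.

(** Schanuel's argument: [al] and [be] compare two free covers of [C], and the columns of [H]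
    generate the kernel of [g \o qB], which [qB] maps onto the image of [A]. Thus [B] has no finite
    presentation when [A] has none. *)
Lemma exact_fp_sub s (A B C : lmodType R) (i : {linear A -> B}) (g : {linear B -> C})
    a b (A2 : 'M[R]_(a, b)) B2 E :
  regular s -> injective i -> exact_at i g -> surjective g ->
  presents C A2 -> projective_pair s A2 B2 E ->
  finitely_presented B -> finitely_presented A.
Proof.
move=> hs ii ig gs [q [qs qk]] hE [n [m [D [qB [qBs qBk]]]]].
have [AE _] := projective_pairE hs hE.
have [al hal] : exists al, forall v, q (al *m v) = (g \o qB) v.
  by apply: lift_mx => v; apply: qs.
have [be hbe] : exists be, forall v, (g \o qB) (be *m v) = q v.
  apply: lift_mx => v; have [y yE] := gs (q v); have [u uE] := qBs y.
  by exists u; rewrite /= uE.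
have [X hX] : exists X, A2 *m X = 1%:M - al *m be.
  apply: ker_mx => v; apply/qk; rewrite mulmxBl mul1mx linearB -mulmxA hal hbe.
  by rewrite subrr.
have [Y hY] : exists Y, A2 *m Y = al *m D.
  apply: ker_mx => v; apply/qk; rewrite -mulmxA hal /=.
  have -> : qB (D *m v) = 0 by apply/qBk; exists v.
  by rewrite linear0.
pose H := row_mx (be *m A2) (1%:M - be *m al).
have [qA hqA] : exists qA : {linear 'cV[R]_(b + n) -> A},
    forall v, i (qA v) = (qB \o mulmx H) v.
  apply: linear_factor => // v; apply/ig => /=.
  have gqB x y z : g (qB (x + (y - z))) = g (qB x) + (g (qB y) - g (qB z)).
    by rewrite !(linearD, linearN).
  rewrite -[v]vsubmxK mul_row_col mulmxBl mul1mx gqB -!mulmxA.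
  rewrite ![g (qB (be *m _))]hbe hal /=.
  have -> : q (A2 *m usubmx v) = 0 by apply/qk; exists (usubmx v).
  by rewrite add0r subrr.
(* [H] maps the three block columns to zero, to [D] and to zero: they come from
   [A2 *m X = 1%:M - al *m be], from the relations of [B], and from the kernel of [A2]. *)
exists (b + n)%N, (a + (m + b))%N,
  (block_mx (- X) (row_mx Y (1%:M - E)) be (row_mx D 0)); exists qA; split.
  move=> x; have [z zE] := qBs (i x).
  have /qk[t tE] : q (al *m z) = 0 by rewrite hal /= zE; apply/ig; exists x.
  exists (col_mx t z); apply: ii; rewrite hqA /= mul_row_col -mulmxA tE mulmxBl mul1mx.
  by rewrite -mulmxA addrC subrK.
move=> w; have -> : qA w = 0 <-> qB (H *m w) = 0.
  rewrite -[qB _]hqA; split => [->|e]; first by rewrite linear0.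
  by apply: ii; rewrite e linear0.
rewrite qBk; split.
  case=> v; rewrite -[w]vsubmxK; set w1 := usubmx w; set w2 := dsubmx w.
  rewrite /H mul_row_col mulmxBl mul1mx -!mulmxA => e.
  (* The coefficients of [w] on the three block columns are [u], [v] and the defect [t], which lies
     in the kernel of [A2]. *)
  pose u := al *m w2 - A2 *m w1.
  have w2E : w2 = be *m u + D *m v.
    rewrite e /u mulmxBr; move: (be *m _) (be *m _) => x y.
    by apply/matrixP => k l; rewrite !mxE; ring.
  pose t := w1 + X *m u - Y *m v.
  have tE : A2 *m t = 0.
    rewrite mulmxBr mulmxDr !mulmxA hX hY mulmxBl mul1mx -!mulmxA.
    have -> : al *m (D *m v) = al *m w2 - al *m (be *m u).
      by rewrite {1}w2E mulmxDr addrC addKr.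
    rewrite /u mulmxBr mulmxBr; move: (A2 *m _) (al *m w2) (al *m _) (al *m _) => x y z k.
    by apply/matrixP => l l'; rewrite !mxE; ring.
  have Et := projective_pair_ker hs hE tE.
  exists (col_mx u (col_mx v t)); rewrite mul_block_col !mul_row_col mul0mx addr0 -w2E.
  congr (col_mx _ _); rewrite mulNmx mulmxBl mul1mx Et subr0 /t.
  move: (X *m _) (Y *m _) => x y.
  by apply/matrixP => l l'; rewrite !mxE; ring.
case=> u0; rewrite -[u0]vsubmxK -[dsubmx u0]vsubmxK; set u := usubmx u0.
set v := usubmx _; set t := dsubmx _.
rewrite mul_block_col !mul_row_col mul0mx addr0 => <-; exists v.
rewrite /H mul_row_col -mulmxA !mulmxDr mulNmx mulmxN mulmxBl mul1mx mulmxBr.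
rewrite (mulmxA A2 X) hX (mulmxA A2 E) AE subrr mulmx0 addr0.
rewrite (mulmxA A2 Y) hY !mulmxBl !mul1mx mulmxN mulmxBr -!mulmxA.
move: (be *m u) (D *m v) (be *m _) (be *m _) => x y z k.
by apply/matrixP => l l'; rewrite !mxE; ring.
Qed.

End Modules.

(** * Submodules, quotients and projective modules *)

Section Submodule.
Variables (R : comNzRingType) (V : lmodType R) (A : set V).
Hypotheses (A0 : A 0) (AP : forall a x y, A x -> A y -> A (a *: x + y)).

Record submod := Submod { submod_val :> V; submodP : A submod_val }.
HB.instance Definition _ := gen_eqMixin submod.
HB.instance Definition _ := gen_choiceMixin submod.

Lemma submod_inj : injective submod_val.
Proof.
by case=> x hx [y hy] /= e; move: hx hy; rewrite e => hx hy; rewrite (Prop_irrelevance hx hy).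
Qed.

Lemma submodD_subproof (x y : submod) : A ((x : V) + (y : V)).
Proof. by rewrite -[x : V]scale1r; apply: AP; apply: submodP. Qed.
Lemma submodZ_subproof a (x : submod) : A (a *: (x : V)).
Proof. by rewrite -[a *: _]addr0; apply: AP => //; apply: submodP. Qed.
Lemma submodN_subproof (x : submod) : A (- (x : V)).
Proof. by rewrite -scaleN1r; apply: submodZ_subproof. Qed.
Definition submod0 := Submod A0.
Definition submod_add x y := Submod (submodD_subproof x y).
Definition submod_opp x := Submod (submodN_subproof x).
Definition submod_scale a x := Submod (submodZ_subproof a x).

Lemma submod_addA : associative submod_add.
Proof. by move=> x y z; apply: submod_inj; apply: addrA. Qed.
Lemma submod_addC : commutative submod_add.
Proof. by move=> x y; apply: submod_inj; apply: addrC. Qed.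
Lemma submod_add0 : left_id submod0 submod_add.
Proof. by move=> x; apply: submod_inj; apply: add0r. Qed.
Lemma submod_addN : left_inverse submod0 submod_opp submod_add.
Proof. by move=> x; apply: submod_inj; apply: addNr. Qed.
HB.instance Definition _ := GRing.isZmodule.Build submod
  submod_addA submod_addC submod_add0 submod_addN.

Lemma submod_scaleA a b x : submod_scale a (submod_scale b x) = submod_scale (a * b) x.
Proof. by apply: submod_inj; apply: scalerA. Qed.
Lemma submod_scale1 : left_id 1 submod_scale.
Proof. by move=> x; apply: submod_inj; apply: scale1r. Qed.
Lemma submod_scaleDr : right_distributive submod_scale +%R.
Proof. by move=> a x y; apply: submod_inj; apply: scalerDr. Qed.
Lemma submod_scaleDl x : {morph submod_scale^~ x : a b / a + b}.
Proof. by move=> a b; apply: submod_inj; apply: scalerDl. Qed.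
HB.instance Definition _ := GRing.Zmodule_isLmodule.Build R submod
  submod_scaleA submod_scale1 submod_scaleDr submod_scaleDl.

Lemma submodule : exists (W : lmodType R) (i : {linear W -> V}),
  injective i /\ forall v, A v <-> exists w, i w = v.
Proof.
have [i hi] := @linear_pack R submod V submod_val (fun _ _ _ => erefl).
exists submod, i; split; first by move=> x y; rewrite !hi; apply: submod_inj.
move=> v; split=> [hv|[w <-]]; last by rewrite hi; apply: submodP.
by exists (Submod hv); rewrite hi.
Qed.

Definition quot_rel (x y : V) : bool := `[< A (x - y) >].
Lemma quot_refl : reflexive quot_rel.
Proof. by move=> x; apply/asboolP; rewrite subrr. Qed.
Lemma quot_sym : symmetric quot_rel.
Proof.
suff h x y : quot_rel x y -> quot_rel y x by move=> x y; apply/idP/idP; apply: h.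
by move=> /asboolP hxy; apply/asboolP; rewrite -opprB; apply: (submodN_subproof (Submod hxy)).
Qed.
Lemma quot_trans : transitive quot_rel.
Proof.
move=> y x z /asboolP hxy /asboolP hyz; apply/asboolP.
by have := submodD_subproof (Submod hxy) (Submod hyz); rewrite /= subrKA.
Qed.
Canonical quot_equiv := EquivRel quot_rel quot_refl quot_sym quot_trans.
Definition quotmod := {eq_quot quot_rel}.
HB.instance Definition _ := Choice.on quotmod.
HB.instance Definition _ := Quotient.on quotmod.
HB.instance Definition _ : EqQuotient _ quot_rel quotmod := EqQuotient.on quotmod.
Local Notation "\p x" := (\pi_quotmod x) (at level 10).

Lemma quot_eq x y : A (x - y) <-> \p x = \p y.
Proof. by split=> [h|/eqmodP/asboolP//]; apply/eqmodP/asboolP. Qed.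
Lemma quot_repr x : A (repr (\p x) - x).
Proof. by apply/quot_eq; rewrite reprK. Qed.

Definition quot_add (x y : quotmod) : quotmod := \p (repr x + repr y).
Definition quot_opp (x : quotmod) : quotmod := \p (- repr x).
Definition quot_scale a (x : quotmod) : quotmod := \p (a *: repr x).
Lemma quot_addE x y : quot_add (\p x) (\p y) = \p (x + y).
Proof.
apply/quot_eq; have := submodD_subproof (Submod (quot_repr x)) (Submod (quot_repr y)).
by rewrite /= addrACA opprD.
Qed.
Lemma quot_oppE x : quot_opp (\p x) = \p (- x).
Proof.
by apply/quot_eq; have := submodN_subproof (Submod (quot_repr x)); rewrite /= opprD.
Qed.
Lemma quot_scaleE a x : quot_scale a (\p x) = \p (a *: x).
Proof.
by apply/quot_eq; have := submodZ_subproof a (Submod (quot_repr x)); rewrite /= scalerBr.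
Qed.
Lemma quot_addA : associative quot_add.
Proof.
elim/quotW=> x; elim/quotW=> y; elim/quotW=> z.
by rewrite (quot_addE y z) (quot_addE x y) (quot_addE x) (quot_addE _ z) addrA.
Qed.
Lemma quot_addC : commutative quot_add.
Proof.
by elim/quotW=> x; elim/quotW=> y; rewrite (quot_addE x y) (quot_addE y x) addrC.
Qed.
Lemma quot_add0 : left_id (\p 0) quot_add.
Proof. by elim/quotW=> x; rewrite quot_addE add0r. Qed.
Lemma quot_addN : left_inverse (\p 0) quot_opp quot_add.
Proof. by elim/quotW=> x; rewrite quot_oppE quot_addE addNr. Qed.
HB.instance Definition _ := GRing.isZmodule.Build quotmod
  quot_addA quot_addC quot_add0 quot_addN.
Lemma quot_scaleA a b x : quot_scale a (quot_scale b x) = quot_scale (a * b) x.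
Proof. by move: x; elim/quotW => x; rewrite (quot_scaleE b x) !quot_scaleE scalerA. Qed.
Lemma quot_scale1 : left_id 1 quot_scale.
Proof. by elim/quotW=> x; rewrite quot_scaleE scale1r. Qed.
Lemma quot_scaleDr : right_distributive quot_scale +%R.
Proof.
move=> a; elim/quotW=> x; elim/quotW=> y.
by rewrite [_ + _](quot_addE x y) !quot_scaleE [RHS]quot_addE scalerDr.
Qed.
Lemma quot_scaleDl x : {morph quot_scale^~ x : a b / a + b}.
Proof.
by move=> a b; move: x; elim/quotW => x; rewrite !quot_scaleE [RHS]quot_addE scalerDl.
Qed.
HB.instance Definition _ := GRing.Zmodule_isLmodule.Build R quotmod
  quot_scaleA quot_scale1 quot_scaleDr quot_scaleDl.

Lemma quotient_module : exists (W : lmodType R) (q : {linear V -> W}),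
  surjective q /\ forall v, q v = 0 <-> A v.
Proof.
have [q hq] : exists q : {linear V -> quotmod}, forall v, q v = \p v.
  apply: linear_pack => a x y.
  by rewrite -[RHS]/(quot_add (quot_scale a (\p x)) (\p y)) (quot_scaleE a x) quot_addE.
exists quotmod, q; split.
  by elim/quotW=> v; exists v; rewrite hq.
by move=> v; rewrite hq -quot_eq subr0.
Qed.

End Submodule.

Section Projective.
Import freeg.
Variable R : comNzRingType.


(** An arbitrary list containing the support allows several elements to be expanded over one list,
    which makes linearity visible. *)
Lemma fglift_dom (M : lmodType R) (K : choiceType) (f : K -> M) (D : {freeg K / R}) t :
  uniq t -> {subset dom D <= t} -> fglift f D = \sum_(k <- t) coeff k D *: f k.
Proof.
move=> ut sD; pose g : {additive {freeg K / R} -> M} :=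
  HB.pack (fglift f) (GRing.isZmodMorphism.Build _ _ _ (lift_is_additive f)).
have e : D = \sum_(k <- t) << coeff k D *g k >>.
  rewrite -[LHS]freeg_sumE [RHS](bigID (mem (dom D))) /= [X in _ + X]big1 ?addr0; last first.
    by move=> k /coeff_outdom ->; apply/eqP; rewrite freegU_eq0.
  rewrite -[in RHS]big_filter; apply: perm_big; apply: uniq_perm.
  - exact: uniq_dom.
  - exact: filter_uniq.
  - by move=> k; rewrite mem_filter; case kD: (k \in dom D) => //=; rewrite sD.
rewrite -[LHS]/(g D) {1}e raddf_sum; apply: eq_bigr => k _; exact: liftU.
Qed.

Lemma fglift_linear (M : lmodType R) (K : choiceType) (f : K -> M) :
  exists g : {linear {freeg K / R} -> M}, forall x, g x = fglift f x.
Proof.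
apply: linear_pack => c x y.
have du : uniq (undup (dom x ++ dom y)) by apply: undup_uniq.
have hx : {subset dom x <= undup (dom x ++ dom y)}.
  by move=> k; rewrite mem_undup mem_cat => ->.
have hy : {subset dom y <= undup (dom x ++ dom y)}.
  by move=> k; rewrite mem_undup mem_cat orbC => ->.
have hxy : {subset dom (c *: x + y) <= undup (dom x ++ dom y)}.
  by move=> k /domD_subset; rewrite mem_cat => /orP[/domZ_subset/hx|/hy].
rewrite !(fglift_dom f du) // scaler_sumr -big_split; apply: eq_bigr => k _ /=.
by rewrite coeffD coeffZ scalerDl scalerA.
Qed.

(* The dual basis lemma, truncated to finitely many coordinates. *)
Lemma projective_dual_basis (Q : lmodType R) a (y : 'I_a -> Q) : projective Q ->
  exists b (t : 'I_b -> Q) (phi : Q -> 'cV[R]_b),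
  [/\ forall c x x', phi (c *: x + x') = c *: phi x + phi x' &
      forall s x (c : 'I_a -> R), regular s -> s *: x = \sum_j c j *: y j ->
        x = \sum_i phi x i 0 *: t i].
Proof.
move=> pQ; have [g hg] := fglift_linear (fun x : Q => x).
have gs : surjective g.
  by move=> x; exists << x >>; rewrite hg liftU scale1r.
have [sg hsg] := pQ _ _ g idfun gs.
(* Finitely many basis elements suffice to express the images of all the [y j] under the section
   [sg]. *)
pose T := undup (flatten [seq dom (sg (y j)) | j <- enum 'I_a]).
have hT j : {subset dom (sg (y j)) <= T}.
  move=> k hk; rewrite mem_undup; apply/flattenP; exists (dom (sg (y j))) => //.
  by apply/mapP; exists j => //; rewrite mem_enum.
exists (size T), (fun i => nth 0 T i), (fun x => \col_i coeff (nth 0 T i) (sg x)).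
split.
  by move=> c x x'; apply/matrixP => i j; rewrite !mxE linearP coeffD coeffZ.
move=> s x c rs sx; transitivity (g (sg x)); first by rewrite hsg.
rewrite hg (@fglift_dom _ _ _ _ T) ?undup_uniq //; last first.
  (* A coordinate of [sg x] outside [T] is killed by [s], hence is zero by regularity. *)
  move=> k; apply: contraTT => kT; rewrite mem_dom negbK; apply/eqP/rs.
  rewrite -coeffZ -linearZ sx linear_sum raddf_sum /= big1 // => j _.
  rewrite linearZ coeffZ coeff_outdom ?mulr0 //.
  by apply: contra kT; apply: hT.
by rewrite (big_nth 0) big_mkord; apply: eq_bigr => i _; rewrite mxE.
Qed.

(** By Schanuel, the kernel of [q] is a direct summand of the sum of [Q1] and [R^a]: it embeds by
    sending [v] to [(x, v)] with [f x = al v], and [be \o f] together with [1 - be \o al] retracts.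
    In dual basis coordinates [A] is the retraction, and [B] is the embedding precomposed with [s],
    which maps [R^a] into the kernel. *)
Lemma pd_le1_projective_pair (P : lmodType R) a (q : {linear 'cV[R]_a -> P}) s :
  pd_le1 P -> surjective q -> regular s -> (forall x : P, s *: x = 0) ->
  exists b (A : 'M[R]_(a, b)) B E,
    (forall v, q v = 0 <-> exists w : 'cV[R]_b, A *m w = v) /\ projective_pair s A B E.
Proof.
move=> [Q1 [Q0 [f [g [[pQ1 pQ0] fi fg gs]]]]] qs rs sP.
have [al hal] := cV_lift q gs.
have [be hbe] := pQ0 _ _ q g qs.
have [ga hga] : exists ga : {linear 'cV[R]_a -> Q1}, forall v,
    f (ga v) = al (s *: v).
  have [u hu] : exists u : {linear 'cV[R]_a -> Q0}, forall v, u v = al (s *: v).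
    by apply: linear_pack => c x y; rewrite scalerDr scalerA mulrC -scalerA linearP.
  have [v hv] : exists v : {linear 'cV[R]_a -> Q1}, forall x, f (v x) = u x.
    apply: linear_factor => // x; apply/fg; rewrite hu hal linearZ.
    exact: sP.
  by exists v => x; rewrite hv hu.
have [b [t [phi [phiL phiE]]]] := projective_dual_basis (fun j => ga (delta_mx j 0)) pQ1.
have [Phi hPhi] : exists Phi : {linear Q1 -> 'cV[R]_b}, forall x, Phi x = phi x.
  by apply: linear_pack.
have alK v : q v = 0 -> exists x, f x = al v.
  by move=> qv; apply/fg; rewrite hal.
(* [s *: x] lies in the span of the chosen vectors [ga (delta_mx j 0)], as the truncated dual basis
   requires. *)
have alKE v x : f x = al v -> s *: x = \sum_j v j 0 *: ga (delta_mx j 0).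
  by move=> e; rewrite -cV_lin; apply: fi; rewrite hga !linearZ /= e.
have [T hT] := cV_map (fun i => be (f (t i))).
have mxE' (c d : nat) (h : {linear 'cV[R]_c -> 'cV[R]_d}) :
    exists N, forall v, N *m v = h v.
  by apply: (@lift_mx _ _ _ _ idfun h) => v; exists (h v).
have [A1 hA1] := mxE' _ _ T; have [N hN] := mxE' _ _ (be \o al).
have [Bt hBt] := mxE' _ _ (Phi \o ga).
have TE x v : f x = al v -> T (phi x) = be (al v).
  move=> e; rewrite hT -e [in RHS](phiE s x (v^~ 0) rs (alKE _ _ e)).
  by rewrite !linear_sum; apply: eq_bigr => i _; rewrite !linearZ.
pose A := row_mx A1 (1%:M - N).
have AE x v : f x = al v -> A *m col_mx (phi x) v = v.
  by move=> e; rewrite mul_row_col hA1 (TE _ _ e) mulmxBl mul1mx hN /= addrC subrK.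
have qA w : q (A *m w) = 0.
  rewrite -[w]vsubmxK mul_row_col hA1 mulmxBl mul1mx hN linearD linearB /= hbe hal subrr addr0.
  rewrite hT linear_sum big1 // => i _; rewrite linearZ hbe /=.
  by have -> : g (f (t i)) = 0 by [apply/fg; exists (t i)]; rewrite scaler0.
pose B := col_mx Bt s%:M.
have BE x v : f x = al v -> B *m v = s *: col_mx (phi x) v.
  move=> e; rewrite mul_col_mx scale_col_mx mul_scalar_mx; congr (col_mx _ _).
  have -> : phi x = Phi x by rewrite hPhi.
  by rewrite hBt -linearZ /=; congr (Phi _); apply: fi; rewrite hga !linearZ /= e.
(* The columns of [A] lie in the kernel of [q], where [BE] shows that [B] is divisible by [s]. *)
have [E hE] : exists E : 'M[R]_(b + a), forall j, B *m col j A = s *: col j E.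
  apply: (cols_choice (Q := fun j e => B *m col j A = s *: e)) => j.
  have /alK[x xE] : q (col j A) = 0 by rewrite -mulmx_delta.
  by exists (col_mx (phi x) (col j A)); apply: BE.
exists (b + a)%N, A, B, E; split.
  move=> v; split=> [/alK[x /AE e]|[w <-] //]; by exists (col_mx (phi x) v).
split; last by apply: cV_ext => v; rewrite -mulmxA -scalemxAl (mulmx_colE E) (mulmx_colE A)
  linear_sum scaler_sumr; apply: eq_bigr => j _; rewrite linearZ /= hE !scalerA mulrC.
apply: cV_ext => v; rewrite -mulmxA mul_scalar_mx -[RHS](AE (ga v)); last by rewrite hga.
congr (A *m _); rewrite mul_col_mx mul_scalar_mx; congr (col_mx _ _).
by rewrite hBt /= hPhi.
Qed.

End Projective.

(** * Fitting invariants *)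

Section FittingInvariants.
Variables (R : comNzRingType) (S : set R).
Hypothesis S_regular : forall s, S s -> regular s.
Local Notation "I ** J" := (Omega_mul I J) (at level 40, left associativity).
Implicit Types (M N P Q T W : lmodType R).

Lemma denominator_regular s : denominator S s -> regular s.
Proof.
case=> t ht ->; elim: t ht => [|x t IH] ht r; rewrite ?big_nil ?mul1r //.
rewrite big_cons -mulrA => /S_regular h; apply: IH.
  by move=> y yt; apply: ht; rewrite inE yt orbT.
by apply: h; apply: ht; rewrite mem_head.
Qed.

(* Every object of the category P has this property; it is what multiplicativity
   of the Fitting ideal needs. *)
Definition pair_presented M : Prop :=
  exists s a b (A : 'M[R]_(a, b)) B E,
    [/\ denominator S s, presents M A & projective_pair s A B E].

(** The inverse is generated by the maximal minors of [B] divided by [s^a]: a minor of [B] times one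
    of [A] is a minor of [s *: E], and Cauchy-Binet writes [s^a], the determinant of [A *m B],
    through such products. The second clause tests the inclusion of [z J] in [K] on generators;
    there [v] may vary with [g] because the inverse of [s] is unique. *)
Lemma minors_ideal_unit s a b (A : 'M[R]_(a, b)) B E :
  denominator S s -> projective_pair s A B E ->
  exists J, minors_ideal S A ** J = Omega1 S /\
    forall z K, (forall g : {ffun 'I_a -> 'I_b}, exists v,
      v * to_loc S s = 1 /\ Omega_set K (z * (v ^+ a * to_loc S (\det (rowsub g B))))) ->
    forall w, Omega_set J w -> Omega_set K (z * w).
Proof.
move=> ds [AB BA]; have [v vs] := to_loc_inv ds.
have vsX n := to_loc_invX n vs.
pose J := Omega_span [seq v ^+ a * to_loc S (\det (rowsub g B)) | g : {ffun 'I_a -> 'I_b}].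
have Jm (g : {ffun 'I_a -> 'I_b}) : Omega_set J (v ^+ a * to_loc S (\det (rowsub g B))).
  by apply/span_sub/mapP; exists g => //; rewrite mem_enum.
exists J; split; last first.
  move=> z K h w [t [ht ->]]; rewrite big_distrr /=.
  have [k eK] := OmegaP K; rewrite eK; apply: span_sum => u /ht /mapP[g _ ->].
  rewrite mulrCA; apply: spanZ; rewrite -eK; have [v' [v's]] := h g.
  suff -> : v' = v by [].
  by rewrite -[v']mulr1 -vs mulrCA v's mulr1.
apply: Omega_ext.
  apply: Omega_mul_le => x y [t [ht ->]] [t' [ht' ->]].
  have [k eK] := OmegaP (Omega1 S); rewrite eK.
  rewrite big_distrl; apply: span_sum => u /ht /mapP[f _ ->].
  rewrite big_distrr; apply: span_sum => u' /ht' /mapP[g _ ->] /=.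
  rewrite mulrACA -to_locM; apply: spanZ; rewrite -eK mulrCA -to_locM. 
  have -> : \det (colsub f A) * \det (rowsub g B) = s ^+ a * \det (mxsub g f E).
    rewrite mulrC -det_mulmx -mxsub_mul BA -detZ; congr (\det _).
    by apply/matrixP => i j; rewrite !mxE.
  by rewrite to_locM mulrA vsX mul1r; apply: Omega1_mem.
apply: Omega_span_le => x; rewrite /= inE => /eqP ->; rewrite -(vsX a).
have -> : s ^+ a = \det (A *m B) by rewrite AB det_scalar.
have hJ := Omega_ideal_like (minors_ideal S A ** J) (v ^+ a).
apply: (cauchy_binet_mem hJ) => f; rewrite to_locM mulrCA.
apply: Omega_mul_mem => //; exact: minors_mem.
Qed.

Lemma Fitt_unit M : pair_presented M -> Omega_unit (Fitt S M).
Proof.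
case=> s [a [b [A [B [E [ds pA hE]]]]]]; rewrite (Fitt_presents S pA).
by have [J [e _]] := minors_ideal_unit ds hE; exists J.
Qed.

(** Choosing columns within each block gives one inclusion. For the other, [X] is removed by a
    matrix whose determinant is a power of [s], and the factor from [A] is split off by means of the
    inverse ideal. *)
Lemma minors_block s a' b' a b (A' : 'M[R]_(a', b')) X (A : 'M[R]_(a, b)) B E :
  denominator S s -> projective_pair s A B E -> X *m E = X ->
  minors_ideal S (block_mx A' X 0 A) = minors_ideal S A' ** minors_ideal S A.
Proof.
move=> ds hE XE; have rs := denominator_regular ds; have [AB BA] := hE.
have [AE EB] := projective_pairE rs hE.
apply: Omega_ext; last first.
  apply: Omega_mul_le => x y [t [ht ->]] [t' [ht' ->]].
  have [k eK] := OmegaP (minors_ideal S (block_mx A' X 0 A)); rewrite eK.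
  rewrite big_distrl; apply: span_sum => u /ht /mapP[f _ ->].
  rewrite big_distrr; apply: span_sum => u' /ht' /mapP[g _ ->] /=.
  rewrite mulrACA -to_locM; apply: spanZ; rewrite -eK -to_locM.
  pose h := [ffun i => match fintype.split i with
    | inl i => lshift b (f i) | inr i => rshift b' (g i) end].
  have <- : \det (colsub h (block_mx A' X 0 A)) = \det (colsub f A') * \det (colsub g A).
    rewrite -(det_ublock _ (colsub g X)); congr (\det _); apply/matrixP => i j.
    rewrite !mxE; case: (splitP i) => i' _; rewrite !mxE ffunE;
      by case: (splitP j) => j' _; rewrite ?(unsplitK (inl _)) ?(unsplitK (inr _)) !mxE.
  exact: minors_mem.
apply: minors_le => f.
(* over S^-1 R the block matrix is a unimodular matrix times diag(A', A) *)
have -> : \det (colsub f (block_mx A' X 0 A)) = \det (colsub f (block_mx A' 0 0 A)).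
  apply/eqP; rewrite -subr_eq0; apply/eqP; apply: (@regularX _ s (a' + a) rs).
  rewrite mulrBr -!detZ; apply/eqP; rewrite subr_eq0; apply/eqP.
  pose U := block_mx s%:M (X *m B) 0 s%:M.
  have eU : U *m block_mx A' 0 0 A = s *: block_mx A' X 0 A.
    rewrite mulmx_block !mulmx0 !mul0mx !addr0 add0r !mul_scalar_mx scale_block_mx scaler0.
    by rewrite -mulmxA BA -scalemxAr XE add0r.
  have -> : s *: colsub f (block_mx A' X 0 A) = U *m colsub f (block_mx A' 0 0 A).
    by rewrite mulmx_colsub eU; apply/matrixP => i j; rewrite !mxE.
  by rewrite det_mulmx det_ublock !det_scalar -exprD -detZ.
(* With [1] written in the product of the ideal of [A] and [J], it suffices that the minor times [J]
   lies in the ideal of [A']. *)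
have [J [AJ hJ]] := minors_ideal_unit ds hE.
rewrite -[to_loc _ _]mulr1.
have : Omega_set (Omega1 S) 1 by apply: Omega1_mem 1.
rewrite -AJ => -[t [ht ->]]; rewrite big_distrr.
have [k eK] := OmegaP (minors_ideal S A' ** minors_ideal S A); rewrite eK.
apply: span_sum => u /ht [x hx [y hy <-]] /=; rewrite mulrCA; apply: spanZ; rewrite -eK.
rewrite (mulrC x) mulrA; apply: Omega_mul_mem => //.
apply: hJ hy => g; have [v vs] := to_loc_inv ds; exists v; split=> //.
have vsX := to_loc_invX a vs.
rewrite mulrCA -to_locM.
pose Eg := rowsub g E.
(* Rows of [B] turn the lower block into [s *: Eg], which releases the factor [s^a]; the upper rows
   remain multiples of [A'], so Laplace expansion applies. *)
have -> : \det (colsub f (block_mx A' 0 0 A)) * \det (rowsub g B) =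
    s ^+ a * \det (colsub f (block_mx A' 0 0 Eg)).
  have -> : \det (rowsub g B) = \det (block_mx (1%:M : 'M_a') 0 0 (rowsub g B)).
    by rewrite det_ublock det1 mul1r.
  have -> : s ^+ a = \det (block_mx (1%:M : 'M_a') 0 0 (s%:M : 'M_a)).
    by rewrite det_ublock det1 mul1r det_scalar.
  rewrite mulrC -!det_mulmx !mulmx_colsub !mulmx_block !mulmx0 !mul0mx !addr0 !add0r !mul1mx.
  rewrite mul_scalar_mx; congr (\det (colsub f (block_mx _ _ _ _))).
  by rewrite /Eg mul_rowsub_mx BA; apply/matrixP => i j; rewrite !mxE.
rewrite to_locM mulrA vsX mul1r.
have [hI hm] := minors_ideal_like S A'.
have := det_col_mx_minors_up (colsub f (row_mx 1%:M 0)) (colsub f (row_mx 0 Eg)) hI hm.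
rewrite mul1r mulmx_colsub mul_mx_row mulmx1 mulmx0.
congr (Omega_set _ (to_loc S (\det _))).
by apply/matrixP => i j; rewrite !mxE; case: (fintype.split i) => i'; rewrite !mxE.
Qed.

(** If [A] is finitely presented, the horseshoe presentation is block triangular. Otherwise [B] is
    not finitely presented either, and both sides are [Omega0]. *)
Lemma Fitt_exact (A B C : lmodType R) (i : {linear A -> B}) (g : {linear B -> C}) :
  injective i -> exact_at i g -> surjective g -> pair_presented C ->
  Fitt S B = Fitt S A ** Fitt S C.
Proof.
move=> ii ig gs [s [a [b [A2 [B2 [E [ds pC hE]]]]]]].
have rs := denominator_regular ds.
have [[a' [b' [A' pA]]]|nA] := pselect (finitely_presented A).
  have [X [pB XE]] := horseshoe rs ii ig gs pA pC hE.
  by rewrite (Fitt_presents S pA) (Fitt_presents S pB) (Fitt_presents S pC) (minors_block _ ds hE XE).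
rewrite (@Fitt_npresents _ S A) ?(@Fitt_npresents _ S B) ?Omega_mul0 //.
  move=> n m D pB; apply: nA; apply: (exact_fp_sub rs ii ig gs pC hE).
  by exists n, m, D.
by move=> n m D pA; apply: nA; exists n, m, D.
Qed.

(** The quasi-inverse is [s * s'] times the formal inverse of the block triangular matrix; the
    off-diagonal block of the other product vanishes because [X *m E = X]. *)
Lemma pair_presented_ext (A B C : lmodType R) (i : {linear A -> B}) (g : {linear B -> C}) :
  injective i -> exact_at i g -> surjective g -> pair_presented A -> pair_presented C ->
  pair_presented B.
Proof.
move=> ii ig gs [s' [a' [b' [A' [B' [E' [ds' pA hE']]]]]]].
move=> [s [a [b [A2 [B2 [E [ds pC hE]]]]]]].
have rs := denominator_regular ds; have [AB BA] := hE; have [AB' BA'] := hE'.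
have [AE EB] := projective_pairE rs hE.
have [X [pB XE]] := horseshoe rs ii ig gs pA pC hE.
exists (s * s'), (a' + a)%N, (b' + b)%N, (block_mx A' X 0 A2).
exists (block_mx (s *: B') (- (B' *m X *m B2)) 0 (s' *: B2)), (block_mx E' 0 0 E).
split=> //; first exact: denominatorM.
split.
  rewrite mulmx_block !mulmx0 !mul0mx !addr0 !add0r -!scalemxAr AB AB' !mulmxN !mulmxA AB'.
  rewrite mul_scalar_mx -scalemxAl addNr !scale_scalar_mx mulrC.
  by rewrite -scalar_mx_block mulrC.
rewrite mulmx_block !mulmx0 !mul0mx !addr0 !add0r scale_block_mx !scaler0.
rewrite -!scalemxAl BA BA' !scalerA mulNmx -!mulmxA BA -!scalemxAr XE subrr.
by rewrite (mulrC s').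
Qed.

Lemma fg_cV M : finitely_generated M ->
  exists a (q : {linear 'cV[R]_a -> M}), surjective q.
Proof.
case=> t ht; have [q hq] := cV_map (fun i : 'I_(size t) => t`_i).
exists (size t), q => x; have [c ->] := ht x; exists (\col_i c i).
by rewrite hq; apply: eq_bigr => i _; rewrite mxE.
Qed.

(** The annihilators of the generators are multiplied, which is why a [denominator] appears. *)
Lemma fg_torsion_annihilator M : in_M S M ->
  exists2 s, denominator S s & forall x : M, s *: x = 0.
Proof.
case=> [[t ht] tor].
have [s ds hs] : exists2 s, denominator S s & forall x, x \in t -> s *: x = 0.
  elim: {ht} t => [|x t [s ds hs]]; first by exists 1; [exact: denominator1|].
  have [r Sr rx] := tor x; exists (r * s).
    apply: denominatorM => //; exists [:: r]; last by rewrite big_seq1.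
    by move=> y; rewrite inE => /eqP ->.
  move=> y; rewrite inE => /orP[/eqP ->|/hs yt]; first by rewrite mulrC -scalerA rx scaler0.
  by rewrite -scalerA yt scaler0.
exists s => // x; have [c ->] := ht x; rewrite scaler_sumr big1 // => i _.
by rewrite scalerA mulrC -scalerA hs ?scaler0 // mem_nth.
Qed.

Lemma in_P_pair_presented M : in_P S M -> pair_presented M.
Proof.
move=> [hM pd]; have [a [q qs]] := fg_cV hM.1.
have [s ds sM] := fg_torsion_annihilator hM.
have [b [A [B [E [qA hE]]]]] := pd_le1_projective_pair pd qs (denominator_regular ds) sM.
by exists s, a, b, A, B, E; split=> //; exists q.
Qed.

Lemma kernel_module (A B : lmodType R) (g : {linear A -> B}) :
  exists W (i : {linear W -> A}), injective i /\ exact_at i g.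
Proof.
apply: (@submodule _ _ [set x | g x = 0]) => /=; first exact: linear0.
by move=> a x y hx hy; rewrite linearP hx hy scaler0 addr0.
Qed.

Lemma pullback_module (A B C : lmodType R) (f : {linear A -> C}) (g : {linear B -> C}) :
  exists W (p : {linear W -> A}) (q : {linear W -> B}),
  [/\ forall w, f (p w) = g (q w),
      forall x y, f x = g y -> exists w, p w = x /\ q w = y &
      forall w, p w = 0 -> q w = 0 -> w = 0].
Proof.
have [d hd] : exists d : {linear (A * B)%type -> C}, forall z, d z = f z.1 - g z.2.
  apply: linear_pack => a x y.
  by rewrite /= (linearP f) (linearP g) scalerBr opprD addrACA.
have [W [i [ii id]]] := kernel_module d.
have [p hp] : exists p : {linear W -> A}, forall w, p w = (i w).1.
  by apply: linear_pack => a x y; rewrite linearP.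
have [q hq] : exists q : {linear W -> B}, forall w, q w = (i w).2.
  by apply: linear_pack => a x y; rewrite linearP.
exists W, p, q; split.
- move=> w; apply/eqP; rewrite -subr_eq0 hp hq -hd; apply/eqP/id; by exists w.
- move=> x y e; have /id[w wE] : d (x, y) = 0 by rewrite hd e subrr.
  by exists w; rewrite hp hq wE.
- move=> w; rewrite hp hq => e1 e2; apply: ii; rewrite linear0.
  by case: (i w) e1 e2 => x y /= -> ->.
Qed.

(** An element with zero component in [P'] has its other component in the kernel of [g], which is
    [N]. Neither map to [T] need be onto, hence the condition on images in the last clause. *)
Lemma pullback_exact N P P' T (f : {linear N -> P}) (g : {linear P -> T})
    (g' : {linear P' -> T}) W (p : {linear W -> P}) (q : {linear W -> P'}) :
  injective f -> exact_at f g -> (forall w, g (p w) = g' (q w)) ->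
  (forall x y, g x = g' y -> exists w, p w = x /\ q w = y) ->
  (forall w, p w = 0 -> q w = 0 -> w = 0) ->
  exists j : {linear N -> W}, [/\ injective j, exact_at j q &
    (forall y, exists x, g x = g' y) -> surjective q].
Proof.
move=> fi fg pq pqS pq0.
have ker x : exists w, p w = f x /\ q w = 0.
  apply: pqS; rewrite linear0; apply/fg; by exists x.
have uniq w w' : p w = p w' -> q w = q w' -> w = w'.
  move=> e1 e2; apply/eqP; rewrite -subr_eq0; apply/eqP/pq0.
    by rewrite linearB e1 subrr.
  by rewrite linearB e2 subrr.
have [j hj] : exists j : {linear N -> W}, forall x, p (j x) = f x /\ q (j x) = 0.
  pose j x := projT1 (cid (ker x)).
  have hj x : p (j x) = f x /\ q (j x) = 0 := projT2 (cid (ker x)).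
  have [j' hj'] : exists j' : {linear N -> W}, forall x, j' x = j x.
    apply: linear_pack => a x y; have [e1 e2] := hj x; have [e3 e4] := hj y.
    have [e5 e6] := hj (a *: x + y).
    by apply: uniq; rewrite linearP ?e1 ?e2 ?e3 ?e4 ?e5 ?e6 ?linearP // scaler0 addr0.
  by exists j' => x; rewrite hj'.
exists j; split.
- by move=> x y e; apply: fi; rewrite -(hj x).1 -(hj y).1 e.
- move=> w; split=> [qw|[x <-]]; last exact: (hj x).2.
  have /fg[x xE] : g (p w) = 0 by rewrite pq qw linear0.
  by exists x; apply: uniq; [rewrite (hj x).1|rewrite (hj x).2].
- by move=> im y; have [x xE] := im y; have [w [_ wE]] := pqS _ _ xE; exists w.
Qed.

(** The fibre product of [P] and [P'] over [T] is an extension of [P'] by [N] and of [P] by [N'];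
    both sides compute its Fitting ideal. *)
Lemma Fitt_syzygy N N' P P' T (f : {linear N -> P}) (g : {linear P -> T})
    (f' : {linear N' -> P'}) (g' : {linear P' -> T}) :
  injective f -> exact_at f g -> injective f' -> exact_at f' g' ->
  (forall z, (exists x, g x = z) <-> (exists y, g' y = z)) ->
  pair_presented P -> pair_presented P' ->
  Fitt S N ** Fitt S P' = Fitt S N' ** Fitt S P.
Proof.
move=> fi fg fi' fg' im hP hP'.
have [W [p [q [pq pqS pq0]]]] := pullback_module g g'.
have [j [ji jq]] := pullback_exact fi fg pq pqS pq0.
have /[swap] /[apply] qs : forall y, exists x, g x = g' y by move=> y; apply/im; exists y.
have [j' [ji' jq']] :
    exists j : {linear N' -> W}, [/\ injective j, exact_at j p &
      (forall y, exists x, g' x = g y) -> surjective p].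
  apply: (pullback_exact fi' fg' (W := W) (q := p) (p := q)) => //.
  - by move=> x y e; have [w [? ?]] := pqS _ _ (esym e); exists w.
  - by move=> w hp hq; apply: pq0.
have /[swap] /[apply] qs' : forall y, exists x, g' x = g y by move=> y; apply/im; exists y.
by rewrite -(Fitt_exact ji jq qs hP') -(Fitt_exact ji' jq' qs' hP).
Qed.

Lemma quotient_cV s n : exists T (tau : {linear 'cV[R]_n -> T}),
  surjective tau /\ forall v, tau v = 0 <-> exists w, s *: w = v.
Proof.
apply: (@quotient_module _ _ [set v | exists w, s *: w = v]) => /=.
  by exists 0; rewrite scaler0.
move=> a _ _ [w <-] [w' <-]; exists (a *: w + w').
by rewrite scalerDr !scalerA mulrC.
Qed.

Lemma quotient_cV_pair_presented s n T (tau : {linear 'cV[R]_n -> T}) :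
  denominator S s -> surjective tau -> (forall v, tau v = 0 <-> exists w, s *: w = v) ->
  pair_presented T.
Proof.
move=> ds ts tk; exists s, n, n, s%:M, 1%:M, 1%:M; split=> //.
  exists tau; split=> // v; rewrite tk; split=> -[w <-]; exists w; by rewrite mul_scalar_mx.
by split; rewrite ?mulmx1 // mul1mx scalemx1.
Qed.

(** [Q] is the quotient of the image of [A] by [s R^n], the image of [A *m B]. As the kernel of [A]
    is the image of [1%:M - E], [Q] is [R^b] modulo the columns of [B] and of [1%:M - E]: the
    matrices [A] and [B] exchange roles. *)
Lemma cover_kernel_pair_presented s n P T Q (tau : {linear 'cV[R]_n -> T})
    (t : {linear T -> P}) (j : {linear Q -> T}) :
  pd_le1 P -> denominator S s -> (forall x : P, s *: x = 0) ->
  surjective tau -> (forall v, tau v = 0 <-> exists w, s *: w = v) ->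
  surjective t -> injective j -> exact_at j t -> pair_presented Q.
Proof.
move=> pd ds sP ts tk st ji jt; have rs := denominator_regular ds.
have sq : surjective (t \o tau).
  by move=> x; have [y <-] := st x; have [v <-] := ts y; exists v.
have [b [A [B [E [qA hE]]]]] := pd_le1_projective_pair pd sq rs sP.
have [AE EB] := projective_pairE rs hE; have [AB BA] := hE.
have EE : E *m E = E.
  by apply: (regular_scale_mx rs); rewrite scalemxAl -BA -mulmxA AE.
have FF : (1%:M - E) *m (1%:M - E) = 1%:M - E.
  by rewrite mulmxBl !mulmxBr !mul1mx mulmx1 EE subrr subr0.
have [qQ hqQ] : exists qQ : {linear 'cV[R]_b -> Q}, forall w, j (qQ w) = (tau \o mulmx A) w.
  apply: linear_factor => // w; apply/jt; apply/(qA (A *m w)); by exists w.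
exists s, b, (n + b)%N, (row_mx B (1%:M - E)), (col_mx A (s *: (1%:M - E))).
exists (block_mx 1%:M 0 0 (1%:M - E)); split=> //; last first.
  split; first by rewrite mul_row_col -scalemxAr FF BA -scalerDr addrC subrK scalemx1.
  rewrite mul_col_row AB -!scalemxAl FF mulmxBr mulmx1 AE subrr mulmxBl mul1mx EB subrr.
  by rewrite !scaler0 scale_block_mx !scaler0 scalemx1.
exists qQ; split.
  move=> x; have [v vE] := ts (j x).
  have /qA[w wE] : (t \o tau) v = 0 by rewrite /= vE; apply/jt; exists x.
  by exists w; apply: ji; rewrite hqQ /= wE.
move=> w; have -> : qQ w = 0 <-> tau (A *m w) = 0.
  rewrite -[tau _]hqQ; split=> [->|e]; first by rewrite linear0.
  by apply: ji; rewrite e linear0.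
rewrite tk; split=> [[v e]|[u <-]].
  have : A *m (w - B *m v) = 0 by rewrite mulmxBr mulmxA AB mul_scalar_mx e subrr.
  move/(projective_pair_ker rs hE) => e'.
  exists (col_mx v (w - B *m v)); rewrite mul_row_col mulmxBl mul1mx e' subr0.
  by rewrite addrC subrK.
exists (usubmx u); rewrite -[in RHS](vsubmxK u) mul_row_col mulmxDr !mulmxA AB mul_scalar_mx.
by rewrite mulmxBr mulmx1 AE subrr mul0mx addr0.
Qed.

(** [W] is the fibre product of [P1] and [T] over [P2]. It is an extension of [P1] by [Q], just as
    [T] is one of [P2] by [Q], whence the relation between Fitting ideals. *)
Lemma resolution_cover N P1 P2 T Q (f : {linear N -> P1}) (g : {linear P1 -> P2})
    (t : {linear T -> P2}) (j : {linear Q -> T}) :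
  injective f -> exact_at f g -> pair_presented P1 -> pair_presented P2 -> pair_presented Q ->
  surjective t -> injective j -> exact_at j t ->
  exists W (f' : {linear N -> W}) (g' : {linear W -> T}),
  [/\ injective f', exact_at f' g', forall z, (exists x, g' x = z) <-> (exists y, g y = t z),
     pair_presented W & Fitt S W ** Fitt S P2 = Fitt S P1 ** Fitt S T].
Proof.
move=> fi fg hP1 hP2 hQ st ji jt.
have [W [p [q [pq pqS pq0]]]] := pullback_module g t.
have [f' [fi' fq _]] := pullback_exact fi fg pq pqS pq0.
have [i [ii ip ps]] : exists i : {linear Q -> W}, [/\ injective i, exact_at i p &
      (forall y, exists x, t x = g y) -> surjective p].
  apply: (pullback_exact ji jt (W := W) (q := p) (p := q)) => //.
  - by move=> x y e; have [w [? ?]] := pqS _ _ (esym e); exists w.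
  - by move=> w hp hq; apply: pq0.
have {}ps : surjective p by apply: ps => y; have [x xE] := st (g y); exists x.
exists W, f', q; split=> //.
- move=> z; split=> [[w <-]|[y e]]; first by exists (p w).
  by have [w [_ <-]] := pqS _ _ e; exists w.
- exact: pair_presented_ext ii ip ps hQ hP1.
rewrite (Fitt_exact ii ip ps hP1) (Fitt_exact ji jt st hP2).
by rewrite -Omega_mulA Omega_mulC -!Omega_mulA; congr (_ ** _); rewrite Omega_mulC.
Qed.

Lemma Fitt2_independent M N P1 P2 N' P1' P2' (f : {linear N -> P1}) (g : {linear P1 -> P2})
    (h : {linear P2 -> M}) (f' : {linear N' -> P1'}) (g' : {linear P1' -> P2'})
    (h' : {linear P2' -> M}) :
  resolution S f g h -> resolution S f' g' h' ->
  Omega_inv (Fitt S P1) ** Fitt S P2 ** Fitt S N =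
  Omega_inv (Fitt S P1') ** Fitt S P2' ** Fitt S N'.
Proof.
move=> [[_ hP1 hP2 _] fi fg gh hs] [[_ hP1' hP2' _] fi' fg' gh' hs'].
have [a [q qs]] := fg_cV hP2.1.1; have [a' [q' qs']] := fg_cV hP2'.1.1.
(* [la] and [la'] lift the generators of each module to the other, so that [u] and [u'] below are
   onto and agree in [M]. *)
have [la hla] : exists la : {linear 'cV[R]_a -> P2'}, forall v, h' (la v) = (h \o q) v.
  exact: cV_lift.
have [la' hla'] : exists la' : {linear 'cV[R]_a' -> P2}, forall v, h (la' v) = (h' \o q') v.
  exact: cV_lift.
have [s2 ds2 sP2] := fg_torsion_annihilator hP2.1.
have [s2' ds2' sP2'] := fg_torsion_annihilator hP2'.1.
(* A common annihilator of [P2] and [P2'], so that one module [T], a power of [R/s], covers both. *)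
pose s := s2 * s2'.
have ds : denominator S s by apply: denominatorM.
have {}sP2 (x : P2) : s *: x = 0 by rewrite /s mulrC -scalerA sP2 scaler0.
have {}sP2' (x : P2') : s *: x = 0 by rewrite -scalerA sP2' scaler0.
have [T [tau [ts tk]]] := quotient_cV s (a + a').
have factor (P : lmodType R) (u : {linear 'cV[R]_(a + a') -> P}) : (forall x : P, s *: x = 0) ->
    exists t : {linear T -> P}, forall v, t (tau v) = u v.
  move=> sP; pose c x := projT1 (cid (ts x)).
  have cE x : tau (c x) = x := projT2 (cid (ts x)).
  have uE v w : tau v = tau w -> u v = u w.
    move=> e; have /tk[k kE] : tau (v - w) = 0 by rewrite linearB e subrr.
    by apply/eqP; rewrite -subr_eq0 -linearB -kE linearZ /= sP.
  have [t ht] : exists t : {linear T -> P}, forall x, t x = u (c x).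
    apply: linear_pack => k x y; rewrite -linearP; apply: uE.
    by rewrite linearP !cE.
  by exists t => v; rewrite ht; apply: uE; rewrite cE.
have [u hu] : exists u : {linear 'cV[R]_(a + a') -> P2},
    forall v, u v = q (usubmx v) + la' (dsubmx v).
  by apply: linear_pack => c x y; rewrite !linearP /= scalerDr addrACA.
have [u' hu'] : exists u' : {linear 'cV[R]_(a + a') -> P2'},
    forall v, u' v = la (usubmx v) + q' (dsubmx v).
  by apply: linear_pack => c x y; rewrite !linearP /= scalerDr addrACA.
have [t ht] := factor _ u sP2; have [t' ht'] := factor _ u' sP2'.
have st : surjective t.
  move=> x; have [v <-] := qs x; exists (tau (col_mx v 0)).
  by rewrite ht hu col_mxKu col_mxKd linear0 addr0.
have st' : surjective t'.
  move=> x; have [v <-] := qs' x; exists (tau (col_mx 0 v)).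
  by rewrite ht' hu' col_mxKu col_mxKd linear0 add0r.
have htt' z : h (t z) = h' (t' z).
  by have [v <-] := ts z; rewrite ht ht' hu hu' !linearD hla hla'.
have [Q [j [ji jt]]] := kernel_module t; have [Q' [j' [ji' jt']]] := kernel_module t'.
have hQ := cover_kernel_pair_presented hP2.2 ds sP2 ts tk st ji jt.
have hQ' := cover_kernel_pair_presented hP2'.2 ds sP2' ts tk st' ji' jt'.
have uT := Fitt_unit (quotient_cV_pair_presented ds ts tk).
have /in_P_pair_presented pP1 := hP1; have /in_P_pair_presented pP2 := hP2.
have /in_P_pair_presented pP1' := hP1'; have /in_P_pair_presented pP2' := hP2'.
have [W [fW [gW [fWi fgW imW hW eW]]]] := resolution_cover fi fg pP1 pP2 hQ st ji jt.
have [W' [fW' [gW' [fWi' fgW' imW' hW' eW']]]] :=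
  resolution_cover fi' fg' pP1' pP2' hQ' st' ji' jt'.
(* [gW] and [gW'] have the same image, the kernel of [h \o t], which equals [h' \o t']. *)
have e : Fitt S N ** Fitt S W' = Fitt S N' ** Fitt S W.
  apply: (Fitt_syzygy fWi fgW fWi' fgW') => // z; rewrite imW imW'.
  by rewrite -[X in X <-> _]gh -[X in _ <-> X]gh' htt'.
have u1 := Fitt_unit pP1; have u1' := Fitt_unit pP1'.
(* Multiplication by this unit removes both inverses; the rest follows from [e], [eW] and [eW']. *)
apply: (Omega_mulIl (Omega_unitM (Omega_unitM u1 u1') uT)).
move: (Omega_mulV u1) (Omega_mulV u1') e eW eW'.
move: (Omega_inv (Fitt S P1)) (Omega_inv (Fitt S P1')) => i1 i1'.
move: (Fitt S P1) (Fitt S P1') => p1 p1'.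
move: (Fitt S P2) (Fitt S P2') (Fitt S T) (Fitt S W) (Fitt S W') (Fitt S N) (Fitt S N').
move=> p2 p2' tT w w' n n' e1 e1' e ew ew'.
rewrite [LHS]((@Omega_mul R S).[AC (3*3) ((1*4)*(2*3)*(5*6))])%AC.
rewrite [RHS]((@Omega_mul R S).[AC (3*3) ((2*4)*(1*3)*(5*6))])%AC.
rewrite e1 e1' !Omega_mul1 -ew -ew'.
rewrite [LHS]((@Omega_mul R S).[AC (2*2) ((4*1)*(2*3))])%AC e.
by rewrite [LHS]((@Omega_mul R S).[AC (2*2) ((2*4)*(3*1))])%AC.
Qed.

End FittingInvariants.

(** * The Grothendieck group and the value on a resolution *)

Section K0.
Variables (R : comNzRingType) (S : set R).
Hypothesis S_regular : forall s, S s -> regular s.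
Local Notation "I ** J" := (Omega_mul I J) (at level 40, left associativity).
Local Notation F := (@Fitt_seq R S).

Lemma Fitt_seq_cat s t : F (s ++ t) = F s ** F t.
Proof.
by elim: s => [|P s IH] /=; rewrite ?Omega_mul1 // IH Omega_mulA.
Qed.

Lemma Fitt_seq_unit s : Omega_unit (F s).
Proof.
elim: s => [|P s IH] /=; first by exists (Omega1 S); rewrite Omega_mul1.
apply: Omega_unitM => //; apply: Fitt_unit.
exact/(in_P_pair_presented S_regular)/(PobjP P).
Qed.

(** In cross-multiplied form each generating relation is an identity of products; invertibility
    enters in the transitivity case. *)
Lemma K0_eq_Fitt x y : K0_eq x y -> F x.1 ** F y.2 = F y.1 ** F x.2.
Proof.
elim=> {x y} //=.
- move=> x y z _ e1 _ e2; apply: (Omega_mulIl (Fitt_seq_unit y.2)).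
  rewrite Omega_mulA (Omega_mulC (F y.2)) e1.
  rewrite [LHS]((@Omega_mul R S).[AC (2*1) ((1*3)*2)])%AC e2.
  by rewrite [LHS]((@Omega_mul R S).[AC (2*1) (2*(1*3))])%AC.
- move=> x y x' y' _ e1 _ e2; rewrite !Fitt_seq_cat.
  rewrite [LHS]((@Omega_mul R S).[AC (2*2) ((1*3)*(2*4))])%AC e1 e2.
  by rewrite [LHS]((@Omega_mul R S).[AC (2*2) ((1*3)*(2*4))])%AC.
- by move=> x y; rewrite !Fitt_seq_cat (Omega_mulC (F x.1)) (Omega_mulC (F x.2)).
- by move=> P; rewrite Omega_mulC.
- move=> A B C [i [g [ii ig gs]]]; rewrite !Omega_mul1r.
  apply: (Fitt_exact S_regular ii ig gs).
  exact/(in_P_pair_presented S_regular)/(PobjP C).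
Qed.

Lemma Fitt_K0_diff P1 P2 (h1 : in_P S P1) (h2 : in_P S P2) :
  Fitt_K0 (K0_diff h1 h2) = Fitt S P1 ** Omega_inv (Fitt S P2).
Proof.
have u2 := Fitt_unit (in_P_pair_presented S_regular h2).
rewrite /Fitt_K0; case: xgetP => [I _ [y /K0_eq_Fitt /= e ->]|]; last first.
  move=> /(_ (F [:: MkPobj h1] ** Omega_inv (F [:: MkPobj h2]))) [].
  by exists ([:: MkPobj h1], [:: MkPobj h2]) => //; exact: K0_refl.
rewrite !Omega_mul1r in e.
apply: (Omega_mulIl (Omega_unitM u2 (Fitt_seq_unit y.2))).
rewrite [LHS]((@Omega_mul R S).[AC (2*2) ((3*1)*(2*4))])%AC -e.
rewrite (Omega_mulV (Fitt_seq_unit _)).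
rewrite [RHS]((@Omega_mul R S).[AC (2*2) ((3*2)*(1*4))])%AC.
by rewrite (Omega_mulV u2).
Qed.

(** Independence evaluates [Fitt2] on the given resolution, and the factors of [P1] and [P2] cancel
    against their inverses. *)
Lemma Fitt_resolution (N P1 P2 M : lmodType R) (h1 : in_P S P1) (h2 : in_P S P2)
    (f : {linear N -> P1}) (g : {linear P1 -> P2}) (h : {linear P2 -> M}) :
  resolution S f g h -> Fitt S N = Fitt_K0 (K0_diff h1 h2) ** Fitt2 S M.
Proof.
move=> res; rewrite Fitt_K0_diff.
have -> : Fitt2 S M = Omega_inv (Fitt S P1) ** Fitt S P2 ** Fitt S N.
  rewrite /Fitt2; case: xgetP => [I _ [N' [P1' [P2' [f' [g' [h' [res' ->]]]]]]]|].
    exact: (Fitt2_independent S_regular res' res).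
  move=> /(_ (Omega_inv (Fitt S P1) ** Fitt S P2 ** Fitt S N)) [].
  by exists N, P1, P2, f, g, h.
rewrite [RHS]((@Omega_mul R S).[AC (2*3) ((1*3)*(4*2)*5)])%AC.
have u1 := Fitt_unit (in_P_pair_presented S_regular h1).
have u2 := Fitt_unit (in_P_pair_presented S_regular h2).
by rewrite (Omega_mulV u1) (Omega_mulV u2) !Omega_mul1.
Qed.

End K0.

(** * Reduction modulo p *)

Section ModP.
Variables (p : nat) (p_prime : prime p).

Definition pdvd (R : comNzRingType) (x : R) : Prop := exists y, x = p%:R * y.

Section Ring.
Variable R : comNzRingType.
Implicit Types x y z : R.

Lemma pdvd0 : pdvd (0 : R). Proof. by exists 0; rewrite mulr0. Qed.
Lemma pdvdD x y : pdvd x -> pdvd y -> pdvd (x + y).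
Proof. by move=> [a ->] [b ->]; exists (a + b); rewrite mulrDr. Qed.
Lemma pdvdN x : pdvd x -> pdvd (- x).
Proof. by move=> [a ->]; exists (- a); rewrite mulrN. Qed.
Lemma pdvdMl x y : pdvd y -> pdvd (x * y).
Proof. by move=> [a ->]; exists (x * a); rewrite mulrCA. Qed.
Lemma pdvd_sum (I : Type) (s : seq I) (Q : pred I) (F : I -> R) :
  (forall i, Q i -> pdvd (F i)) -> pdvd (\sum_(i <- s | Q i) F i).
Proof. by move=> h; apply: (big_ind (@pdvd R)) h; [exact: pdvd0|exact: pdvdD]. Qed.

Lemma pdvdXX x y k : pdvd (x - y) -> pdvd (x ^+ k - y ^+ k).
Proof. by rewrite subrXX mulrC; apply: pdvdMl. Qed.

(** The inner binomial coefficients ['C(p, i)] are divisible by [p]. *)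
Lemma frobenius_add x y : pdvd ((x + y) ^+ p - (x ^+ p + y ^+ p)).
Proof.
have p0 := prime_gt0 p_prime; rewrite exprDn.
rewrite -(prednK p0) big_ord_recl big_ord_recr /= subn0 bin0 mulr1n mulr1 (prednK p0).
rewrite /bump /= add1n (prednK p0) subnn binn mulr1n mul1r.
rewrite (addrC (\sum_(_ < _) _)) addrA [X in pdvd X]addrC addKr.
apply: pdvd_sum => i _; rewrite add1n.
have /dvdnP[k ->] : (p %| 'C(p, i.+1))%N.
  by apply: prime_dvd_bin => //=; rewrite -[X in (_ < X)%N](prednK p0) ltnS ltn_ord.
by rewrite mulrnA -mulr_natl; exists (x ^+ (p - i.+1) * y ^+ i.+1 *+ k).
Qed.

Lemma frobenius_sum n (I : Type) (s : seq I) (Q : pred I) (F : I -> R) :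
  pdvd ((\sum_(i <- s | Q i) F i) ^+ (p ^ n) - \sum_(i <- s | Q i) F i ^+ (p ^ n)).
Proof.
have p0 n' : (0 < p ^ n')%N by rewrite expn_gt0 prime_gt0.
suff h x y : pdvd ((x + y) ^+ (p ^ n) - (x ^+ (p ^ n) + y ^+ (p ^ n))).
  elim: s => [|i s IH]; first by rewrite !big_nil expr0n -leqn0 leqNgt p0 subr0; exact: pdvd0.
  rewrite !big_cons; case: (Q i) => //.
  have := pdvdD (h (F i) (\sum_(i <- s | Q i) F i)) IH.
  by congr (pdvd _); ring.
elim: n => [|n IH]; first by rewrite !expr1 subrr; exact: pdvd0.
have := pdvdD (pdvdXX p IH) (frobenius_add (x ^+ (p ^ n)) (y ^+ (p ^ n))).
by rewrite -!exprM -!expnSr; congr (pdvd _); ring.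
Qed.

End Ring.

Local Notation Zp := (padic p).
Let p1 : (1 < p)%N := prime_gt1 p_prime.
Let pX1 n : (1 < p ^ n.+1)%N.
Proof. by rewrite -{1}(expn0 p) ltn_exp2l. Qed.

Lemma padic_lt (a : Zp) n : (a n < p ^ n.+1)%N.
Proof. by rewrite -[X in (_ < X)%N](Zp_cast (pX1 n)) ltn_ord. Qed.

Lemma padic_succ (a : Zp) n : a n = (a n.+1 %% p ^ n.+1)%N :> nat.
Proof. by rewrite -(padicP a n) val_Zp_nat. Qed.

Lemma padic_pmul (a : Zp) n : (p%:R * a) n = (p * a n %% p ^ n.+1)%N :> nat.
Proof.
have e k : (a *+ k) n = a n *+ k by elim: k => [|k IH] //; rewrite !mulrS -IH.
by rewrite mulr_natl e -mulr_natl -[a n in LHS]natr_Zp -natrM val_Zp_nat.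
Qed.

(** Level [n] is [Z/p^(n+1)]: at level [n.+1] the equation says that [p^(n+1)] divides [a n.+1], so
    [a n] is zero. *)
Lemma padic_pmul_eq0 (a : Zp) : p%:R * a = 0 -> a = 0.
Proof.
move=> e; apply: padic_ext => n; apply: val_inj; rewrite /= padic_succ.
have := padic_pmul a n.+1; rewrite e /= => /esym/eqP.
move: (nat_of_ord _) => k; rewrite -/(dvdn _ _) [(p ^ n.+2)%N]expnS dvdn_pmul2l ?prime_gt0 //.
by move=> /eqP.
Qed.

Lemma padic_pmul_inj (a b : Zp) : p%:R * a = p%:R * b -> a = b.
Proof.
by move=> e; apply/eqP; rewrite -subr_eq0; apply/eqP/padic_pmul_eq0; rewrite mulrBr e subrr.
Qed.

Lemma pdvd_padic (a : Zp) : pdvd a <-> a 0%N = 0.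
Proof.
split=> [[b ->]|a0]; first by apply: val_inj; rewrite [LHS]padic_pmul; exact: modnMr.
have pa n : (p %| a n)%N.
  elim: n => [|n IH]; first by rewrite a0.
  move: IH; rewrite padic_succ /dvdn modn_dvdm //.
  by rewrite expnS dvdn_mulr.
(* Division by [p] loses one level of precision, hence the shifted index. *)
pose b n : 'Z_(p ^ n.+1) := (a n.+1 %/ p)%:R.
have bP : padic_compat b.
  move=> n; rewrite /b val_Zp_nat // modn_small; last first.
    by rewrite ltn_divLR ?prime_gt0 // -expnSr padic_lt.
  apply: val_inj; rewrite [LHS]val_Zp_nat // [RHS]val_Zp_nat //.
  rewrite !modn_divl -!expnSr -padic_succ modn_small //.
  exact: padic_lt.
exists (Padic bP); apply: padic_ext => n; apply: val_inj.
rewrite [RHS]padic_pmul /= /b val_Zp_nat // modnMmr mulnC divnK // -padic_succ.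
by [].
Qed.

Lemma pdvd_padicM (a b : Zp) : pdvd (a * b) -> pdvd a \/ pdvd b.
Proof.
move/pdvd_padic => /= e.
have {e} : (p %| a 0%N * b 0%N)%N.
  have e' : ((a 0%N * b 0%N)%N%:R : 'Z_(p ^ 1)) = 0 by rewrite natrM !natr_Zp.
  by have := congr1 val e'; rewrite [LHS]val_Zp_nat // => h; apply/eqP.
have lt (x : Zp) : (p %| x 0%N)%N -> pdvd x.
  move=> h; apply/pdvd_padic/val_inj.
  exact: etrans (esym (modn_small (padic_lt x 0))) (eqP h).
by rewrite Euclid_dvdM // => /orP[/lt|/lt]; [left|right].
Qed.

Lemma pdvd_padicX (a : Zp) k : pdvd (a ^+ k) -> (0 < k)%N -> pdvd a.
Proof. by case: k => // k + _; elim: k => // k IH; rewrite exprS => /pdvd_padicM[]. Qed.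

(** Division by [p] lowers the level at which a nonzero entry is seen; this is the descent in
    [iwasawa_primitive_part]. *)
Lemma padic_pmul_neq0 (a : Zp) n : (p%:R * a) n.+1 != 0 -> a n != 0.
Proof.
apply: contraNneq => an0; apply/eqP/val_inj; rewrite [LHS]padic_pmul.
have : (a n.+1 %% p ^ n.+1)%N = 0%N by rewrite -padic_succ an0.
move: (nat_of_ord _) => k /eqP; rewrite -/(dvdn _ _) => /(dvdn_mul (dvdnn p)).
by rewrite -expnS => /eqP.
Qed.

End ModP.

(** * The Iwasawa algebra *)

Section IwasawaAlgebra.
Variables (p : nat) (p_prime : prime p) (G : abTopGroup).
Local Notation R := (iwasawa p G).
Local Notation Zp := (padic p).
Implicit Types (x y z : R) (U V W : openSub G) (g h k : G) (c d : Zp).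

Lemma iwasawa_sumE U g (I : Type) (s : seq I) (Q : pred I) (F : I -> R) :
  (\sum_(i <- s | Q i) F i) U g = \sum_(i <- s | Q i) F i U g.
Proof. by apply: (big_morph (fun x : R => x U g)). Qed.

Lemma iwasawa_natmul U g n x : (n%:R * x) U g = n%:R * x U g.
Proof.
rewrite !mulr_natl; elim: n => [|n IH]; first by rewrite !mulr0n.
by rewrite !mulrS -IH.
Qed.

Lemma single_subproof c g : iwasawa_compat (fun U h => c * group_elt p g U h).
Proof.
split=> [U h k hk|U V UV h]; first by congr (_ * _); case: (iwasawaP (group_elt p g)) => + _; apply.
by case: (iwasawaP (group_elt p g)) => _ /(_ U V UV h) ->; rewrite big_distrr.
Qed.
Definition single c g : R := Iwasawa (single_subproof c g).

Lemma singleE c g U h : single c g U h = if sameco U g h then c else 0.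
Proof. by rewrite /= -/(sameco U g h); case: sameco; rewrite ?mulr1 ?mulr0. Qed.

Lemma single_mulE c g x U h : (single c g * x) U h = c * x U (g^-1 * h)%g.
Proof.
transitivity (\sum_(k <- transv U) single c g U k * x U (k^-1 * h)%g); first by [].
rewrite -[RHS](sum_sameco g _ (transvP U)) [RHS]big_mkcond; apply: eq_bigr => k _.
rewrite singleE; case: ifP => gk; last by rewrite mul0r.
congr (_ * _); apply: iwasawa_invar.
by rewrite ![(_ * h)%g]atg_comm sameco_mull sameco_inv sameco_sym.
Qed.

Lemma single_mul c d g h : single c g * single d h = single (c * d) (g * h)%g.
Proof.
apply: iwasawa_ext => U k; rewrite single_mulE !singleE.
rewrite -(sameco_mull U h _ g) mulgA mulgV mul1g.
by case: ifP => _; rewrite ?mulr0.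
Qed.

Lemma singleX c g n : single c g ^+ n = single (c ^+ n) (g ^+ n)%g.
Proof.
elim: n => [|n IH].
  apply: iwasawa_ext => U k; rewrite singleE expr0 expg0.
  by rewrite /= -/(sameco U 1 k); case: sameco.
by rewrite exprS IH single_mul -exprS -expgS.
Qed.

(* Membership in the kernel of Z_p[[G]] -> F_p[G/U]. *)
Definition vanishes U x : Prop := forall g, pdvd p (x U g).

Lemma vanishesD U x y : vanishes U x -> vanishes U y -> vanishes U (x + y).
Proof. by move=> hx hy g; apply: pdvdD. Qed.
Lemma vanishesN U x : vanishes U x -> vanishes U (- x).
Proof. by move=> hx g; apply: pdvdN. Qed.
Lemma vanishesMl U x y : vanishes U y -> vanishes U (x * y).
Proof. by move=> hy g; apply: pdvd_sum => h _; apply: pdvdMl. Qed.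
Lemma vanishes_pdvd U x : pdvd p x -> vanishes U x.
Proof. by move=> [y ->] g; rewrite iwasawa_natmul; exists (y U g). Qed.
Lemma vanishes_sub U x y z : vanishes U (x - y) -> vanishes U (z * x) -> vanishes U (z * y).
Proof.
move=> h hx; have -> : z * y = z * x - z * (x - y) by ring.
by apply: vanishesD hx _; apply/vanishesN/vanishesMl.
Qed.

(** A finite combination of group elements lifting the part of [x] over [A] in Z_p[G/U]; the
    coefficients at finer levels depend on the representatives. *)
Definition restrict U (A : pred G) x : R := \sum_(h <- transv U | A h) single (x U h) h.

Lemma restrictE U (A : pred G) x g : (forall g h, sameco U g h -> A g = A h) ->
  restrict U A x U g = if A g then x U g else 0.
Proof.
move=> hA; rewrite iwasawa_sumE big_mkcond.
rewrite (eq_bigr (fun h => if sameco U g h then (if A g then x U g else 0) else 0)).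
  by rewrite -big_mkcond /= sum_sameco //; apply: transvP.
move=> h _; rewrite singleE [sameco U h g]sameco_sym; case gh: (sameco U g h); last by case: (A h).
by rewrite (hA _ _ gh) (iwasawa_invar x gh).
Qed.

Lemma restrict_frobenius U A x n :
  vanishes U (restrict U A x ^+ (p ^ n) -
    \sum_(h <- transv U | A h) single (x U h ^+ (p ^ n)) (h ^+ (p ^ n))%g).
Proof.
apply: vanishes_pdvd; under [X in _ - X]eq_bigr do rewrite -singleX.
exact: frobenius_sum.
Qed.

Lemma iwasawa_pmul_eq0 x : p%:R * x = 0 -> x = 0.
Proof.
move=> e; apply: iwasawa_ext => U g; apply: (padic_pmul_eq0 p_prime).
by rewrite -iwasawa_natmul e.
Qed.

Lemma iwasawa_pXmul_eq0 n x : p%:R ^+ n * x = 0 -> x = 0.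
Proof.
by elim: n => [|n IH]; rewrite ?mul1r // exprS -mulrA => /iwasawa_pmul_eq0 /IH.
Qed.

(** Quotients by [p] are unique in Z_p, so the levelwise quotients are compatible. *)
Lemma iwasawa_pdvd x : (forall U, vanishes U x) -> pdvd p x.
Proof.
move=> h; pose y U g : Zp := projT1 (cid (h U g)).
have yE U g : x U g = p%:R * y U g := projT2 (cid (h U g)).
have yP : iwasawa_compat y.
  split=> [U g k /asboolP gk|U V UV g]; apply: (padic_pmul_inj p_prime).
    by rewrite -!yE; apply: iwasawa_invar.
  rewrite -yE (iwasawa_push _ UV) big_distrr; apply: eq_bigr => k _; exact: yE.
exists (Iwasawa yP); apply: iwasawa_ext => U g; rewrite iwasawa_natmul; exact: yE.
Qed.

(** Division by [p] is repeated while possible; it stops because some coefficient is nonzero at a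
    fixed p-adic level, which drops each time. *)
Lemma iwasawa_primitive_part x : x <> 0 ->
  exists n y, x = p%:R ^+ n * y /\ exists U g, ~ pdvd p (y U g).
Proof.
move=> x0.
have [U [g [n]]] : exists U g n, x U g n != 0.
  apply: contrapT => no; apply: x0; apply: iwasawa_ext => U g; apply: padic_ext => n.
  by apply/eqP/negPn/negP => h; apply: no; exists U, g, n.
elim: n x {x0} U g => [|n IH] x U g xn.
  exists 0%N, x; rewrite mul1r; split=> //; exists U, g.
  by move/(pdvd_padic p_prime) => e; rewrite e eqxx in xn.
have [[V [h xh]]|all] := pselect (exists V h, ~ pdvd p (x V h)).
  by exists 0%N, x; rewrite mul1r; split=> //; exists V, h.
have [y yE] : pdvd p x.
  by apply: iwasawa_pdvd => V h; apply: contrapT => xh; apply: all; exists V, h.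
rewrite yE iwasawa_natmul in xn.
have [m [z [zE zu]]] := IH y U g (padic_pmul_neq0 p_prime xn).
by exists m.+1, z; split=> //; rewrite yE zE exprS mulrA.
Qed.

Lemma padic_pXmul_eq0 n (a : Zp) : p%:R ^+ n * a = 0 -> a = 0.
Proof.
by elim: n => [|n IH]; rewrite ?mul1r // exprS -mulrA => /(padic_pmul_eq0 p_prime) /IH.
Qed.

(** * Regularity of elements supported on a p-power filtered subgroup *)

Section Regular.
(** In the application [H] is isomorphic to Z_p^2 and [Un n] is its subgroup of [p^n]-th powers;
    [Un_root] then expresses torsion-freeness. *)
Variables (H : set G) (Un : nat -> openSub G).
Hypotheses (H_subgroup : subgroup H)
  (Un_sub : forall n, Un n `<=` H)
  (Un_le : forall n m, Un (n + m)%N `<=` Un n)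
  (Un_pow0 : forall n g, H g -> Un n (g ^+ (p ^ n))%g)
  (Un_pow : forall n m g, Un n g -> Un (n + m)%N (g ^+ (p ^ m))%g)
  (Un_root : forall n m g, H g -> Un (n + m)%N (g ^+ (p ^ n))%g -> Un m g)
  (Un_base : forall V : openSub G, exists n, Un n `<=` V).

Lemma iwasawa_sub_supp x m g : iwasawa_sub H x -> x (Un m) g != 0 -> H g.
Proof.
move=> hx xg; apply: contrapT => Hg; case/eqP: xg; apply: hx => h Hh /Un_sub h1.
apply: Hg; case: H_subgroup => _ HM HV.
by have := HM _ _ Hh (HV _ h1); rewrite invgM invgK mulgA mulgV mul1g.
Qed.

(* In F_p[G/U_(n+m)], x^(p^n) is supported on the image of U_n, hence also kills
   the restriction y1 of y to U_n; but y1^(p^m) is a nonzero constant. *)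
Lemma iwasawa_mul_neq0_core n m x y k :
  iwasawa_sub H x -> H k -> ~ pdvd p (x (Un m) k) -> ~ pdvd p (y (Un n) 1%g) ->
  x * y <> 0.
Proof.
move=> hx Hk xk y1 xy; pose W := Un (n + m)%N.
have p0 i : (0 < p ^ i)%N by rewrite expn_gt0 prime_gt0.
have W_n : W `<=` Un n by apply: Un_le.
have W_m : W `<=` Un m by rewrite /W addnC; apply: Un_le.
pose z : R := \sum_(h <- transv W) single (x W h ^+ (p ^ n)) (h ^+ (p ^ n))%g.
have xz : vanishes W (x ^+ (p ^ n) - z).
  have e : vanishes W (x - restrict W xpredT x).
    move=> g; rewrite [X in pdvd _ X](_ : _ = 0); first exact: pdvd0.
    by rewrite /= (@restrictE W xpredT x g) // subrr.
  have -> : x ^+ (p ^ n) - z = (x ^+ (p ^ n) - restrict W xpredT x ^+ (p ^ n)) +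
      (restrict W xpredT x ^+ (p ^ n) - z) by ring.
  apply: vanishesD; last exact: restrict_frobenius.
  by rewrite subrXX mulrC; apply: vanishesMl.
(* [x ^+ (p ^ n) * y] is zero because [x * y] is, the exponent being positive. *)
have zy : vanishes W (y * z).
  apply: vanishes_sub xz _; rewrite -(prednK (p0 n)) exprS mulrA (mulrC y) xy mul0r.
  by move=> g; apply: pdvd0.
pose A := [pred h : G | `[< Un n h >]].
have A_inv g h : sameco W g h -> A g = A h.
  move=> gh; have e l : A l = sameco (Un n) 1 l by rewrite /sameco invg1 mul1g.
  by rewrite !e; apply: sameco_eqr; apply: sameco_sub gh.
have z_supp g : ~~ A g -> z W g = 0.
  move=> /asboolP nA; rewrite iwasawa_sumE big1 // => h _; rewrite singleE.
  case: ifP => // hg; have [-> |xh] := eqVneq (x W h) 0.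
    by rewrite expr0n -leqn0 leqNgt p0.
  case: nA; have := A_inv _ _ hg => /=; have Hh := iwasawa_sub_supp hx xh.
  by rewrite asboolT => [/esym/asboolP|]; last exact: Un_pow0.
pose y' := restrict W A y.
have A_div g h : A h -> A (h^-1 * g)%g = A g.
  move=> /asboolP Ah; apply/asboolP/asboolP => [hg|Ag].
    by have := openM Ah hg; rewrite mulgA mulgV mul1g.
  exact: openM (openV Ah) Ag.
(* Modulo [W], [z] is supported on the subgroup [Un n], so multiplication by [z] acts on each coset
   of [Un n] separately. *)
have zy' : vanishes W (y' * z).
  rewrite mulrC => g; have zyE u : (z * u) W g =
      \sum_(h <- transv W | A h) z W h * u W (h^-1 * g)%g.
    rewrite [RHS]big_mkcond; apply: eq_bigr => h _; case: ifP => // /negbT Ah.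
    by rewrite (z_supp _ Ah) mul0r.
  rewrite zyE; have [Ag|Ag] := boolP (A g).
    rewrite (eq_bigr (fun h => z W h * y W (h^-1 * g)%g)).
      by rewrite -zyE mulrC; apply: zy.
    by move=> h Ah; rewrite (restrictE _ _ A_inv) (A_div _ _ Ah) Ag.
  rewrite big1; first exact: pdvd0.
  by move=> h Ah; rewrite (restrictE _ _ A_inv) (A_div _ _ Ah) (negbTE Ag) mulr0.
pose c := \sum_(h <- transv W | A h) y W h ^+ (p ^ m).
have y'c : vanishes W (y' ^+ (p ^ m) - single c 1%g).
  have -> : y' ^+ (p ^ m) - single c 1%g = (y' ^+ (p ^ m) -
      \sum_(h <- transv W | A h) single (y W h ^+ (p ^ m)) (h ^+ (p ^ m))%g) +
    (\sum_(h <- transv W | A h) single (y W h ^+ (p ^ m)) (h ^+ (p ^ m))%g - single c 1%g) by ring.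
  apply: vanishesD; first exact: restrict_frobenius.
  move=> g; rewrite [X in pdvd _ X](_ : _ = 0); first exact: pdvd0.
  apply/eqP; rewrite subr_eq0; apply/eqP; rewrite iwasawa_sumE singleE.
  have -> : sameco W 1 g = `[< W g >] by rewrite /sameco invg1 mul1g.
  transitivity (\sum_(h <- transv W | A h) if `[< W g >] then y W h ^+ (p ^ m) else 0).
    apply: eq_bigr => h /asboolP Ah; rewrite singleE.
    have -> : sameco W (h ^+ (p ^ m)) g = sameco W 1 g.
      rewrite sameco_sym [RHS]sameco_sym; apply: sameco_eqr; rewrite sameco_sym.
      by rewrite /sameco invg1 mul1g; apply/asboolP/Un_pow.
    by rewrite /sameco invg1 mul1g.
  by case: `[< _ >] => //; rewrite big1.
(* By Frobenius, [c] is congruent to the [p^m]-th power of the coefficient of [y] at the coset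
   [Un n]. *)
have cu : ~ pdvd p c.
  move=> hc; apply: y1; apply: (pdvd_padicX p_prime (k := p ^ m)) => //.
  have -> : y (Un n) 1%g = \sum_(h <- transv W | A h) y W h.
    rewrite (iwasawa_push y W_n); apply: eq_bigl => h.
    by rewrite /sameco invg1 mul1g.
  by have := pdvdD (frobenius_sum p_prime m (transv W) A (y W)) hc; rewrite subrK.
(* Further factors [y'] turn [y' * z] into [c] times [z], and [c] is prime to [p]. *)
have zp g : pdvd p (z W g).
  have : vanishes W (z * single c 1%g).
    apply: vanishes_sub y'c _; rewrite -(prednK (p0 m)) exprSr mulrCA.
    by apply: vanishesMl; rewrite mulrC.
  rewrite mulrC => /(_ g); rewrite single_mulE invg1 mul1g.
  by case/(pdvd_padicM p_prime).
apply: xk; apply: (pdvd_padicX p_prime (k := p ^ n)) => //.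
have := zp (k ^+ (p ^ n))%g.
(* By [Un_root] and [Un_pow], elements of [H] have the same [p^n]-th power modulo [W] exactly when
   they agree modulo [Un m]; the sum is thus a Frobenius power of [x (Un m) k] modulo [p]. *)
have -> : z W (k ^+ (p ^ n))%g = \sum_(h <- transv W | sameco (Un m) k h) x W h ^+ (p ^ n).
  rewrite iwasawa_sumE [RHS]big_mkcond; apply: eq_bigr => h _; rewrite singleE.
  have [->|xh] := eqVneq (x W h) 0; first by rewrite expr0n -leqn0 leqNgt p0 !if_same.
  have Hh := iwasawa_sub_supp hx xh; congr (if _ then _ else _).
  have Hhk : H (h^-1 * k)%g by case: H_subgroup => _ HM HV; apply: HM => //; apply: HV.
  have e : ((h ^+ (p ^ n))^-1 * k ^+ (p ^ n) = (h^-1 * k) ^+ (p ^ n))%g.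
    by rewrite expgMn ?expVgn //; apply: atg_comm.
  rewrite [RHS]sameco_sym /sameco e; apply: asbool_equiv_eq; split; first exact: Un_root.
  by rewrite /W addnC; apply: Un_pow.
move=> hz; rewrite (iwasawa_push x W_m).
by have := pdvdD (frobenius_sum p_prime n (transv W) (sameco (Un m) k) (x W)) hz; rewrite subrK.
Qed.

Lemma iwasawa_sub_regular x : iwasawa_sub H x -> x <> 0 -> regular x.
Proof.
move=> hx x0 y xy; apply: contrapT => y0.
have [i [x' [xE [V [g xg]]]]] := iwasawa_primitive_part x0.
have [j [y' [yE [V' [g' yg]]]]] := iwasawa_primitive_part y0.
(* A coefficient is a sum of coefficients at a finer level, so one of these is prime to [p] if it
   is. *)
have refine (u : R) W h : ~ pdvd p (u W h) -> exists n h', ~ pdvd p (u (Un n) h').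
  have [n nW] := Un_base W; move=> hu; exists n; apply: contrapT => no; apply: hu.
  rewrite (iwasawa_push u nW); apply: pdvd_sum => l _; apply: contrapT => ul.
  by apply: no; exists l.
have [m [k xk]] := refine _ _ _ xg; have [n [l yl]] := refine _ _ _ yg.
have hx' : iwasawa_sub H x'.
  move=> W h hh; apply: (@padic_pXmul_eq0 i).
  have eX t : (p%:R ^+ i * t : R) W h = p%:R ^+ i * t W h.
    elim: (i) => [|a IH]; first by rewrite !mul1r.
    by rewrite !exprS -!mulrA iwasawa_natmul IH.
  by rewrite -eX -xE; apply: hx.
have Hk : H k.
  by apply: (iwasawa_sub_supp (m := m) hx'); apply: contra_notN xk => /eqP ->; apply: pdvd0.
(* Translation by [l^-1] moves the coefficient of [y'] at [l] to the identity. *)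
apply: (@iwasawa_mul_neq0_core n m x' (single 1 l^-1%g * y') k) => //.
  by rewrite single_mulE invgK mulg1 mul1r.
rewrite mulrCA; suff -> : x' * y' = 0 by rewrite mulr0.
apply: (@iwasawa_pXmul_eq0 (i + j)); rewrite exprD mulrACA -xE -yE; exact: xy.
Qed.

End Regular.
End IwasawaAlgebra.

Lemma iwasawa_Zp2_regular p (K L : divringClosed algC) (L_ab : abelian_ext K L)
    (H : set (GalT K L)) : prime p -> Gal_open H -> iso_Zp2 p H ->
  forall s : iwasawa p (abGal L_ab),
    (@iwasawa_sub p (abGal L_ab) H `\ (0 : iwasawa p (abGal L_ab))) s -> regular s.
Proof.
move=> p_prime H_open [f [fi fH fD f_open f_base]] s [hs s0].
pose Un n : openSub (abGal L_ab) := @OpenSub (abGal L_ab) _ (f_open n).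
have fX (x : padic p * padic p) k : f (x *+ k) = (f x ^+ k)%g.
  elim: k => [|k IH]; last by rewrite mulrS fD IH expgS.
  by rewrite mulr0n expg0; apply: (mulgI (f 0)); rewrite -fD addr0 mulg1.
have pE n (x : padic p * padic p) : (p%:R ^+ n * x.1, p%:R ^+ n * x.2) = x *+ (p ^ n).
  by case: x => a b; rewrite -!natrX !mulr_natl; elim: (p ^ n)%N => // k IH; rewrite !mulrS -IH.
have UnP n g : Un n g <-> exists x, f (x *+ (p ^ n)) = g.
  split=> [[x _ <-]|[x <-]]; first by exists x; rewrite -pE.
  by exists x => //=; rewrite pE.
have HP g : H g <-> exists x, f x = g.
  rewrite -fH; split=> [[x _ <-]|[x <-]]; by exists x.
apply: (@iwasawa_sub_regular p p_prime (abGal L_ab) H Un) => //.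
- exact: H_open.1.
- by move=> n g /UnP[x <-]; apply/HP; exists (x *+ p ^ n).
- move=> n m g /UnP[x <-]; apply/UnP; exists (x *+ p ^ m).
  by rewrite -mulrnA -expnD addnC.
- by move=> n g /HP[x <-]; apply/UnP; exists x; rewrite fX.
- move=> n m g /UnP[x <-]; apply/UnP; exists x.
  by rewrite -fX -mulrnA -expnD.
(* This is [Un_root]: [p^n x = p^(n+m) y] forces [x = p^m y], as Z_p has no p-torsion. *)
- move=> n m g /HP[x <-]; rewrite -fX => /UnP[y /fi e]; apply/UnP; exists y; congr f.
  have pI k (a : padic p) : a *+ (p ^ k) = 0 -> a = 0.
    by rewrite -mulr_natl natrX; apply: padic_pXmul_eq0.
  apply/eqP; rewrite -subr_eq0; apply/eqP.
  have : (y *+ p ^ m - x) *+ (p ^ n) = 0 by rewrite mulrnBl -mulrnA -expnD addnC e subrr.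
  move: (_ - x) => -[a b] abn.
  have := congr1 fst abn; have := congr1 snd abn; rewrite !raddfMn /= => /pI -> /pI ->.
  by [].
- by move=> V; have [n hn] := f_base _ (openSubP V); exists n => g [x _ <-].
Qed.

Theorem theorem1p6
  (p : nat) (p_prime : prime p) (p_odd : odd p)
  (K : divringClosed algC) (K_imquad : imaginary_quadratic K)
  (P Pbar : set algC) (p_splits : splits_as p K P Pbar)
  (Ktilde : divringClosed algC) (Ktilde_Zp2 : Zp2_extension p K Ktilde)
  (L : divringClosed algC) (L_ab : abelian_ext K L)
  (L_fin : finite_ext Ktilde L)
  (Sigma : set place) (Sigma_fin : finite_set Sigma)
  (Sigma_place : forall v, Sigma v -> is_place K v)
  (Sigma_p : forall v, is_place K v -> above p v -> Sigma v)
  (Sigma_ram : forall v, is_place K v -> ramified K K L v -> Sigma v)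
  (G' : set (GalT K L)) (G'_open : Gal_open G') (G'_Zp2 : iso_Zp2 p G')
  (M : divringClosed algC)
  (M_max : max_ab_pro_p_unram p K L M (Sigma `\ FinitePlace Pbar)) :
  let G := abGal L_ab in
  let R : comNzRingType := iwasawa p G in
  let S : set R := @iwasawa_sub p G G' `\ (0 : R) in
  let Zp : lmodType R := trivial_Zp p G in
  forall (X : lmodType R) (X_Gal : is_Galois_module M X)
    (P1 P2 : lmodType R) (P1_P : in_P S P1) (P2_P : in_P S P2)
    (f : {linear X -> P1}) (g : {linear P1 -> P2}) (h : {linear P2 -> Zp}),
  resolution S f g h ->
  let Phi : K0 S := K0_diff P1_P P2_P in
  Fitt S X = Omega_mul (Fitt_K0 Phi) (Fitt2 S Zp).
Proof.
move=> G R S Zp X _ P1 P2 P1_P P2_P f g h res Phi.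
apply: Fitt_resolution res; exact: iwasawa_Zp2_regular G'_open G'_Zp2.
Qed.
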